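(* Over profiles whose ballots are strict weak orders (ties allowed): (i) the Split Cycle VSCC $SC$ satisfies Anonymity, Neutrality, Homogeneity, Downward Homogeneity, Neutral Indifference, Neutral Reversal, Monotonicity, Coherent IIA, Coherent Defeat, and Tolerant Positive Involvement; (ii) any VSCC $F$ satisfying Anonymity, Neutrality, Downward Homogeneity, Neutral Indifference, Neutral Reversal, Monotonicity for two-candidate profiles, Coherent IIA, Coherent Defeat, and Tolerant Positive Involvement equals $SC$; (iii) the same holds if Downward Homogeneity and Neutral Indifference in (ii) are replaced by Homogeneity.
   Context: Fix infinite sets $\mathcal V$ (voters) and $\mathcal X$ (candidates). For finite $X$, $\mathcal W(X)$ is the set of strict weak orders on $X$ (irreflexive, transitive, negatively transitive); $x,y$ are tied if neither is strictly above the other; the empty relation is allowed. A profile is $\mathbf P:V\to\mathcal W(X)$ with $V\subset\mathcal V$, $X\subset\mathcal X$ nonempty finite; $V(\mathbf P)=V$, $X(\mathbf P)=X$. ''Ranks $x$ above $y$'' means strictly. $\mathbf P_{|Y}$ restricts ballots to $Y$. $\mathrm{Margin}_{\mathbf P}(x,y)$ = #voters with $x$ strictly above $y$ minus #voters with $y$ strictly above $x$; $x$ majority preferred to $y$ if $>0$. $\mathcal M(\mathbf P)$: vertices $X(\mathbf P)$, edge $x\to y$ weighted $\mathrm{Margin}_{\mathbf P}(x,y)$ when positive. Majority paths and their strength (minimum margin along consecutive edges) as usual. $(x,y)\in sc(\mathbf P)$ iff $\mathrm{Margin}_{\mathbf P}(x,y)>0$ exceeds the strength of every majority path from $y$ to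 $x$. A VSCC is a function $F$ with $\varnothing\ne F(\mathbf P)\subseteq X(\mathbf P)$; $SC(\mathbf P)$ is the set of $y$ with no $x$ such that $(x,y)\in sc(\mathbf P)$. Moving up one place: given strict weak order $\succ$ on finite $X$ and $x$ not $\succ$-greatest, let $x'\ne x$ be $\succ$-minimal with $x\not\succ x'$; $\succ'$ results from moving $x$ up one place if it agrees with $\succ$ on pairs not involving $x$, and: if $x$ is tied with $x'$ in $\succ$, then in $\succ'$ $x$ is tied with nothing, $x\succ' x'$, and $y\succ x$ implies $y\succ' x$; if $x$ is tied with nothing in $\succ$, then $x$ is tied with $x'$ in $\succ'$. Axioms for VSCC $F$: Anonymity (permuting which voter has which ballot, same voter set, leaves $F$ unchanged); Neutrality (if a bijection $\pi$ of candidates transforms $\mathbf P$ into $\mathbf P'$ ballot-wise, same voters and candidates, then $x\in F(\mathbf P)\iff\pi(x)\in F(\mathbf P')$); Homogeneity $F(\mathbf P)=F(2\mathbf P)$; Downward Homogeneity $F(\mathbf P)\subseteq F(2\mathbf P)$ ($2\mathbf P$ duplicates each voter); Neutral Indifference (adding a voter with empty ballot leaves $F$ unchanged); Neutral Reversal (adding two voters with converse ballots leaves $F$ unchanged); Monotonicity (resp. for two-candidate profiles): if $\mathbf P'$ arises by moving $x$ up one place in one ballot, $x\in F(\mathbf P)$ implies $x\in F(\mathbf P')$; Coherent IIA: with $\mathbf P\rightsquigarrow_{x,y}\mathbf P'$ meaning $\mathbf P_{|\{x,y\}}=\mathbf P'_{|\{x,y\}}$ and $\mathcal M(\mathbf P')$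 obtainable from $\mathcal M(\mathbf P)$ by deleting zero or more candidates other than $x,y$ and deleting or reducing weights of zero or more edges not connecting $x,y$: if $y\notin F(\mathbf P)$, some $x\in X(\mathbf P)$ has $y\notin F(\mathbf P')$ for all $\mathbf P'$ with $\mathbf P\rightsquigarrow_{x,y}\mathbf P'$; Coherent Defeat: if $\mathrm{Margin}_{\mathbf P}(x,y)>0$ and no majority path from $y$ to $x$, then $y\notin F(\mathbf P)$; Tolerant Positive Involvement: if $x\in F(\mathbf P)$ and $\mathbf P'$ adds one new voter ranking $x$ strictly above every other candidate $y$ to which $x$ is not majority preferred in $\mathbf P$, then $x\in F(\mathbf P')$. *)

(* Defs.v *)
From Stdlib Require Import ClassicalDescription.
From mathcomp Require Import all_boot all_order all_algebra finmap.
Set Implicit Arguments. Unset Strict Implicit. Unset Printing Implicit Defensive.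
Import Order.TTheory GRing.Theory Num.Theory.
Local Open Scope fset_scope.
Local Open Scope ring_scope.

Definition pdec (P : Prop) : bool :=
  if excluded_middle_informative P then true else false.

Definition infinite_type (T : choiceType) : Prop :=
  forall s : {fset T}, exists t : T, t \notin s.

Section Profiles.
Variables (Vt Xt : choiceType).

(* A profile: finite voter set, finite candidate set, and the set of triples
   (v, x, y) meaning "voter v ranks x strictly above y". *)
Record profile := Profile {
  pV : {fset Vt};
  pX : {fset Xt};
  pR : {fset (Vt * Xt * Xt)} }.

Definition ranks (P : profile) (v : Vt) (x y : Xt) : bool := (v, x, y) \in pR P.

Definition strict_weak_order (X : {fset Xt}) (b : rel Xt) : Prop :=
  [/\ (forall x, x \in X -> ~~ b x x),
      (forall x y z, x \in X -> y \in X -> z \in X -> b x y -> b y z -> b x z)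
    & (forall x y z, x \in X -> y \in X -> z \in X ->
          ~~ b x y -> ~~ b y z -> ~~ b x z)].

Definition wf_profile (P : profile) : Prop :=
  [/\ pV P != fset0, pX P != fset0,
      (forall v x y, ranks P v x y -> [/\ v \in pV P, x \in pX P & y \in pX P])
    & (forall v, v \in pV P -> strict_weak_order (pX P) (ranks P v))].

Definition tied (b : rel Xt) (x y : Xt) : bool := ~~ b x y && ~~ b y x.

Definition n_above (P : profile) (x y : Xt) : nat :=
  #|` [fset v in pV P | ranks P v x y] |.

Definition Margin (P : profile) (x y : Xt) : int :=
  (n_above P x y)%:Z - (n_above P y x)%:Z.

Definition maj_pref (P : profile) (x y : Xt) : bool := 0 < Margin P x y.

Definition majority_path (P : profile) (a : Xt) (s : seq Xt) (b : Xt) : Prop :=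
  [/\ s != [::], last a s = b, uniq (a :: s), all (fun c => c \in pX P) (a :: s)
    & path (maj_pref P) a s].

Fixpoint strength (P : profile) (a : Xt) (s : seq Xt) : int :=
  match s with
  | [::] => 0
  | [:: b] => Margin P a b
  | b :: s' => Order.min (Margin P a b) (strength P b s')
  end.

Definition sc (P : profile) (x y : Xt) : Prop :=
  0 < Margin P x y /\
  (forall s, majority_path P y s x -> strength P y s < Margin P x y).

Definition VSCC := profile -> {fset Xt}.

Definition SC : VSCC := fun P =>
  [fset y in pX P | pdec (~ exists x, sc P x y)].

Definition is_VSCC (F : VSCC) : Prop :=
  forall P, wf_profile P -> F P != fset0 /\ F P `<=` pX P.

Definition Anonymity (F : VSCC) : Prop :=
  forall P P' (pi : Vt -> Vt), wf_profile P -> wf_profile P' ->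
    pV P' = pV P -> pX P' = pX P ->
    {in pV P &, injective pi} -> (forall v, v \in pV P -> pi v \in pV P) ->
    (forall v x y, v \in pV P -> ranks P' v x y = ranks P (pi v) x y) ->
    F P = F P'.

Definition Neutrality (F : VSCC) : Prop :=
  forall P P' (pi : Xt -> Xt), wf_profile P -> wf_profile P' ->
    pV P' = pV P -> pX P' = pX P ->
    {in pX P &, injective pi} -> (forall x, x \in pX P -> pi x \in pX P) ->
    (forall v x y, v \in pV P -> x \in pX P -> y \in pX P ->
       ranks P' v (pi x) (pi y) = ranks P v x y) ->
    forall x, x \in pX P -> (x \in F P <-> pi x \in F P').

Definition is_double (P P' : profile) : Prop :=
  pX P' = pX P /\
  exists f : Vt -> Vt,
    [/\ (forall w, w \in pV P' -> f w \in pV P),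
        (forall v, v \in pV P -> #|` [fset w in pV P' | f w == v] | = 2%N)
      & (forall w x y, w \in pV P' -> ranks P' w x y = ranks P (f w) x y)].

Definition Homogeneity (F : VSCC) : Prop :=
  forall P P', wf_profile P -> wf_profile P' -> is_double P P' -> F P = F P'.

Definition Downward_Homogeneity (F : VSCC) : Prop :=
  forall P P', wf_profile P -> wf_profile P' -> is_double P P' -> F P `<=` F P'.

Definition adds_voter (P P' : profile) (v0 : Vt) : Prop :=
  [/\ v0 \notin pV P, pV P' = v0 |` pV P, pX P' = pX P
    & forall v x y, v \in pV P -> ranks P' v x y = ranks P v x y].

Definition Neutral_Indifference (F : VSCC) : Prop :=
  forall P P' v0, wf_profile P -> wf_profile P' -> adds_voter P P' v0 ->
    (forall x y, ~~ ranks P' v0 x y) -> F P = F P'.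

Definition Neutral_Reversal (F : VSCC) : Prop :=
  forall P P' v1 v2, wf_profile P -> wf_profile P' ->
    v1 \notin pV P -> v2 \notin pV P -> v1 != v2 ->
    pV P' = v1 |` (v2 |` pV P) -> pX P' = pX P ->
    (forall v x y, v \in pV P -> ranks P' v x y = ranks P v x y) ->
    (forall x y, ranks P' v2 x y = ranks P' v1 y x) ->
    F P = F P'.

Definition moved_up (X : {fset Xt}) (b b' : rel Xt) (x : Xt) : Prop :=
  x \in X /\
  exists x',
    [/\ [/\ x' \in X, x' != x, ~~ b x x'
          & (forall z, z \in X -> z != x -> ~~ b x z -> ~~ b x' z)],
        (forall y z, y \in X -> z \in X -> y != x -> z != x -> b' y z = b y z),
        (tied b x x' ->
           [/\ (forall y, y \in X -> y != x -> ~~ tied b' x y),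
               b' x x'
             & (forall y, y \in X -> b y x -> b' y x)])
      & ((forall y, y \in X -> y != x -> ~~ tied b x y) -> tied b' x x')].

Definition moves_up_one (P P' : profile) (x : Xt) : Prop :=
  pV P' = pV P /\ pX P' = pX P /\
  exists v, [/\ v \in pV P, moved_up (pX P) (ranks P v) (ranks P' v) x
               & forall w y z, w \in pV P -> w != v -> ranks P' w y z = ranks P w y z].

Definition Monotonicity (F : VSCC) : Prop :=
  forall P P' x, wf_profile P -> wf_profile P' -> moves_up_one P P' x ->
    x \in F P -> x \in F P'.

Definition Monotonicity_two (F : VSCC) : Prop :=
  forall P P' x, wf_profile P -> wf_profile P' -> #|` pX P| = 2%N ->
    moves_up_one P P' x -> x \in F P -> x \in F P'.

Definition iia_rel (P P' : profile) (x y : Xt) : Prop :=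
  [/\ [/\ pV P' = pV P, x \in pX P', y \in pX P' & pX P' `<=` pX P],
      (forall v a b, v \in pV P -> a \in [fset x; y] -> b \in [fset x; y] ->
          ranks P' v a b = ranks P v a b)
    & (forall a b, a \in pX P' -> b \in pX P' -> ~ (a \in [fset x; y] /\ b \in [fset x; y]) ->
          0 < Margin P' a b -> 0 < Margin P a b /\ Margin P' a b <= Margin P a b)].

Definition Coherent_IIA (F : VSCC) : Prop :=
  forall P y, wf_profile P -> y \notin F P ->
    exists x, x \in pX P /\
      forall P', wf_profile P' -> iia_rel P P' x y -> y \notin F P'.

Definition Coherent_Defeat (F : VSCC) : Prop :=
  forall P x y, wf_profile P -> 0 < Margin P x y ->
    ~ (exists s, majority_path P y s x) -> y \notin F P.

Definition Tolerant_Positive_Involvement (F : VSCC) : Prop :=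
  forall P P' v0 x, wf_profile P -> wf_profile P' -> x \in F P ->
    adds_voter P P' v0 ->
    (forall y, y \in pX P -> y != x -> ~~ maj_pref P x y -> ranks P' v0 x y) ->
    x \in F P'.

End Profiles.

(* Main.v *)
Require Import Defs.
From mathcomp Require Import all_boot all_order all_algebra finmap zify.
Set Implicit Arguments. Unset Strict Implicit. Unset Printing Implicit Defensive.
Import Order.TTheory GRing.Theory Num.Theory.
Local Open Scope fset_scope.
Local Open Scope ring_scope.

(** A candidate y loses under SC iff some x has margin m > 0 over y and x is not
    reachable from y by edges of margin at least m; all properties of SC follow.

    SC is contained in F: let y lose under F. Add many pairs of converse ballots
    (all-indifferent ones, and "y on top" with "y at the bottom") and take the
    candidate x given by Coherent IIA. Restricting to {x, y} and using May's
    argument, x has margin m > 0 over y. If x were reachable from y by edges of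
    margin at least m, this path would close into a cycle C. For c in C with
    successor c', the ballots "c > c' > rest" and "rest > {c, c'}" together have c -> c' as
    only margin edge. Taking m copies of them for each c, plus pairs of converse ballots and
    indifferent ballots, one gets a profile on C that has the same {x, y}-ballots
    and weaker margins, so y still loses there. But after removal of the converse
    pairs this profile is invariant under rotating C, so that nobody could win.

    F is contained in SC: let x defeat y with margin m, and suppose y wins under F.
    Double the profile and let S be the set of candidates reachable from y by edges
    of original margin at least m. Tolerant Positive Involvement lets us add 2m - 2 voters who
    weaken every edge from S to its complement until none is left, while x keeps
    margin 2 over y; this contradicts Coherent Defeat. Doubling makes the margins even,
    which is what is needed for the edges leaving y itself. *)

(** * Decisions, counting and permutations on finite sequences *)

Lemma pdecP (P : Prop) : reflect P (pdec P).
Proof. by rewrite /pdec; case: ClassicalDescription.excluded_middle_informative => h; constructor. Qed.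

Lemma fset_count (T : choiceType) (A : {fset T}) (p : pred T) :
  #|` [fset v in A | p v]| = count p A.
Proof.
rewrite cardfE -size_filter.
have /perm_size <- : perm_eq (enum_fset [fset v in A | p v]) (filter p A).
  apply: uniq_perm; rewrite ?fset_uniq ?filter_uniq ?fset_uniq //.
  by move=> v; rewrite !inE mem_filter andbC.
by rewrite -cardfE.
Qed.

Lemma sub_in_count (T : eqType) (s : seq T) (p q : pred T) :
  {in s, forall v, p v -> q v} -> (count p s <= count q s)%N.
Proof.
move=> pq; rewrite (eq_in_count (a2 := predI p q)).
  by apply: sub_count => v /andP [].
by move=> v /pq; rewrite /=; case: (p v) => // ->.
Qed.

Lemma perm_map_self (T : eqType) (f : T -> T) (s : seq T) :
  uniq s -> {in s &, injective f} -> {in s, forall a, f a \in s} -> perm_eq (map f s) s.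
Proof.
move=> us fi fs; have uf : uniq (map f s) by rewrite map_inj_in_uniq.
have sub : {subset map f s <= s} by move=> b /mapP [a /fs fa ->].
have sz : (size s <= size (map f s))%N by rewrite size_map.
by apply: uniq_perm => //; have [_] := uniq_min_size uf sub sz.
Qed.

Lemma fpath_closed (T : eqType) (f : T -> T) (p : pred T) (a : T) (s : seq T) :
  (forall b, p b -> p (f b)) -> fpath f a s -> p a -> all p s.
Proof.
move=> pf; elim: s a => //= b s IH a /andP [/eqP <- fs] pa.
by rewrite pf //=; apply: IH fs (pf _ pa).
Qed.

(** Serves to hand constructed ballots out to voters: once their codes on [x] and [y] form a
    permutation of the given codes, some rearrangement of the ballots agrees with the given codes
    voter by voter. *)
Lemma perm_eq_map_lift (T U S : eqType) (f : T -> U) (g : S -> U) (l1 : seq T) (l2 : seq S) :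
  perm_eq (map f l1) (map g l2) ->
  exists2 l, perm_eq l l2 & map g l = map f l1.
Proof.
case: l2 => [|x0 l2']; first by move/perm_nilP; case: l1 => // _; exists [::].
set l2 := x0 :: l2' => /(perm_iotaP (g x0)) [Is pI ->].
rewrite size_map in pI; exists (map (nth x0 l2) Is).
  by apply/(perm_iotaP x0); exists Is.
rewrite -map_comp; apply/eq_in_map => i; rewrite (perm_mem pI) mem_iota => /andP [_ il].
exact: esym (nth_map x0 (g x0) g il).
Qed.

(** * Split Cycle in terms of reachability *)

Section Reach.
Variables (T : eqType) (M : T -> T -> int).

(** Walks instead of simple paths make transitivity mere concatenation. Nothing confines them to
    candidates, but in a well-formed profile edges of positive margin join candidates. *)
Definition reach (k : int) (a b : T) : Prop :=
  exists s, path (fun a b => k <= M a b) a s /\ last a s = b.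

Lemma reach_refl k a : reach k a a.
Proof. by exists [::]. Qed.

Lemma reach_edge k a b : k <= M a b -> reach k a b.
Proof. by move=> h; exists [:: b]; rewrite /= h. Qed.

Lemma reach_trans k a b c : reach k a b -> reach k b c -> reach k a c.
Proof.
move=> [s [ps ls]] [t [pt lt]]; exists (s ++ t).
by rewrite cat_path last_cat ls ps pt.
Qed.

Lemma reach_le k l a b : k <= l -> reach l a b -> reach k a b.
Proof.
move=> kl [s [ps ls]]; exists s; split=> //.
by apply: sub_path ps => u v; apply: le_trans.
Qed.

(* Unlike [sc], this beatpath relation is transitive; it contains [sc], so its
   maximal elements are undefeated. *)
Definition schulze a b := exists k, [/\ 0 < k, reach k a b & ~ reach k b a].

Lemma schulze_irr a : ~ schulze a a.
Proof. by move=> [k [_ _ []]]; apply: reach_refl. Qed.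

Lemma schulze_trans a b c : schulze a b -> schulze b c -> schulze a c.
Proof.
move=> [k [k0 ab nba]] [l [l0 bc ncb]].
have [kl|/ltW lk] := leP k l.
  exists k; split=> //; first exact: reach_trans ab (reach_le kl bc).
  by move=> ca; apply: nba; apply: reach_trans (reach_le kl bc) ca.
exists l; split=> //; first exact: reach_trans (reach_le lk ab) bc.
by move=> ca; apply: ncb; apply: reach_trans ca (reach_le lk ab).
Qed.

End Reach.

Lemma exists_maximal (T : eqType) (R : T -> T -> Prop) (s : seq T) :
  (forall a, ~ R a a) -> (forall a b c, R a b -> R b c -> R a c) ->
  s != [::] -> exists2 a, a \in s & forall b, b \in s -> ~ R b a.
Proof.
move=> irr tr; elim: s => // a s IH _.
have [->|/IH [c cs cm]] := eqVneq s [::].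
  by exists a; rewrite ?mem_head // => b; rewrite inE => /eqP ->.
have [ac|nac] := pdecP (R a c).
  exists a; first exact: mem_head.
  move=> b; rewrite inE => /predU1P [->//|bs ba].
  by apply: (cm b bs); apply: tr ba ac.
exists c; first by rewrite inE cs orbT.
by move=> b; rewrite inE => /predU1P [->//|/cm].
Qed.

(** * Split Cycle satisfies the axioms *)

Section Margins.
Variables Vt Xt : choiceType.
Implicit Types (P : profile Vt Xt) (x y z a b c : Xt).

Lemma n_aboveE P a b : n_above P a b = count (fun v => ranks P v a b) (pV P).
Proof. exact: fset_count. Qed.

Lemma MarginC P a b : Margin P a b = - Margin P b a.
Proof. by rewrite /Margin opprB. Qed.

Lemma Marginxx P a : Margin P a a = 0.
Proof. by rewrite /Margin subrr. Qed.

Lemma Margin_gt0_mem P a b :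
  wf_profile P -> 0 < Margin P a b -> a \in pX P /\ b \in pX P.
Proof.
move=> [_ _ wfR _]; rewrite /Margin => h.
have : (0 < n_above P a b)%N by lia.
rewrite n_aboveE -has_count => /hasP [v _ /wfR []] //.
Qed.

Lemma le_strength P m a s : s != [::] ->
  (m <= strength P a s) = path (fun a b => m <= Margin P a b) a s.
Proof.
elim: s a => // b s IH a _; case: s IH => [|c s] IH; first by rewrite /= andbT.
by rewrite [strength _ _ _]/= le_min [RHS]/= (IH b).
Qed.

(** Cutting loops out of a walk only drops edges, so a walk whose edges reach the margin yields a
    simple majority path of that strength; conversely, such a strength bounds every edge of the path
    from below. *)
Lemma sc_reach P x y : wf_profile P ->
  sc P x y <-> 0 < Margin P x y /\ ~ reach (Margin P) (Margin P x y) y x.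
Proof.
move=> wfP; split=> -[M0 H]; split=> //.
  move=> [s [ps ls]]; case/shortenP: ps ls => t pt ut _ lt.
  have t0 : t != [::].
    by apply/negP => /eqP t0; move: lt M0; rewrite t0 /= => ->; rewrite Marginxx.
  have /H : majority_path P y t x.
    have pt0 : path (maj_pref P) y t.
      by apply: sub_path pt => a b; apply: lt_le_trans.
    split=> //; rewrite /= (proj2 (Margin_gt0_mem wfP M0)) /=.
    elim: (t) (y) pt0 => //= b u IH a /andP [ab /IH ->].
    by rewrite (proj2 (Margin_gt0_mem wfP ab)).
  by rewrite ltNge le_strength // pt.
move=> s [s0 ls _ _ _]; rewrite ltNge; apply/negP; rewrite le_strength // => ps.
by apply: H; exists s.
Qed.

Lemma in_SC P y : (y \in SC P) = (y \in pX P) && pdec (~ exists x, sc P x y).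
Proof. by rewrite /SC !inE. Qed.

Lemma not_in_SC P y : wf_profile P -> y \in pX P ->
  y \notin SC P <-> exists x, 0 < Margin P x y /\ ~ reach (Margin P) (Margin P x y) y x.
Proof.
move=> wfP yX; rewrite in_SC yX /=; split.
  case: pdecP => // h _; case: (pdecP (exists x, sc P x y)) => // -[x /(sc_reach _ _ wfP)].
  by exists x.
by move=> [x /(sc_reach _ _ wfP) h]; apply/pdecP => -[]; exists x.
Qed.

(** A defeat of [y] by [x] with margin [k] puts [x] above [y] in [schulze] at threshold [k], so a
    maximal element of that relation is undefeated. *)
Lemma SC_VSCC : is_VSCC (@SC Vt Xt).
Proof.
move=> P wfP; split; last by apply/fsubsetP => y; rewrite in_SC => /andP [].
have X0 : enum_fset (pX P) != [::].
  case: wfP => _ /fset0Pn [a aX] _ _.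
  by apply/negP => /eqP h; have: a \in enum_fset (pX P) by []; rewrite h.
have [y yX ymax] := exists_maximal (@schulze_irr _ (Margin P))
  (@schulze_trans _ (Margin P)) X0.
apply/fset0Pn; exists y; apply/negPn/negP => /(not_in_SC wfP yX) [x [M0 H]].
apply: (ymax x); first exact: (proj1 (Margin_gt0_mem wfP M0)).
by exists (Margin P x y); split=> //; apply: reach_edge.
Qed.

(** Defeats only compare margins with 0 and with each other, so renaming candidates and positive
    scaling preserve them. Neutrality, Homogeneity and the axioms under which margins stay the same
    reduce to this. *)
Lemma SC_Margin_map P P' (f : Xt -> Xt) y :
  wf_profile P -> wf_profile P' ->
  {in pX P &, injective f} -> f @` pX P = pX P' ->
  (exists2 c : int, 0 < c &
    {in pX P &, forall a b, Margin P' (f a) (f b) = c * Margin P a b}) ->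
  y \in pX P -> (y \in SC P) = (f y \in SC P').
Proof.
move=> wfP wfP' fi fX [c c0 Mf] yX.
have fyX : f y \in pX P' by rewrite -fX in_imfset.
have mX k a b : 0 < k -> k <= Margin P a b -> a \in pX P /\ b \in pX P.
  by move=> k0 kM; apply: Margin_gt0_mem wfP (lt_le_trans k0 kM).
(* [g] inverts [f] on [pX P'], so that walks can be pulled back; [y] is only a default value. *)
pose g w := odflt y (omap val [pick z : pX P | f (val z) == w]).
have fK w : w \in pX P' -> g w \in pX P /\ f (g w) = w.
  rewrite /g; case: pickP => [z /eqP <- _|n]; first by split=> //=; apply: valP.
  rewrite -fX => /imfsetP [z /= zX wz].
  by have := n [` zX]; rewrite /= wz eqxx.
have gK z : z \in pX P -> g (f z) = z.
  move=> zX; have fzX : f z \in pX P' by rewrite -fX in_imfset.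
  by have [gX fg] := fK _ fzX; apply: fi.
suff: y \notin SC P <-> f y \notin SC P'.
  by case: (y \in SC P); case: (f y \in SC P') => // -[h1 h2];
     [have := h2 isT | have := h1 isT].
rewrite (not_in_SC wfP yX) (not_in_SC wfP' fyX); split.
  move=> [x [M0 H]]; have [xX _] := Margin_gt0_mem wfP M0.
  exists (f x); rewrite Mf // pmulr_rgt0 //; split=> // -[s [ps ls]]; apply: H.
  suff r : reach (Margin P) (Margin P x y) (g (f y)) (g (f x)) by rewrite !gK // in r.
  exists (map g s); rewrite last_map ls; split=> //.
  rewrite path_map; apply: sub_path ps => u v /= h.
  have h0 : 0 < Margin P' u v by apply: lt_le_trans h; rewrite pmulr_rgt0.
  have [/fK [guX fu] /fK [gvX fv]] := Margin_gt0_mem wfP' h0.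
  by move: h; rewrite -{1}fu -{1}fv Mf // ler_pM2l.
move=> [x' [M0 H]]; have [x'X _] := Margin_gt0_mem wfP' M0.
have [xX fx] := fK _ x'X; set x := g x' in xX fx.
move: M0 H; rewrite -fx Mf // pmulr_rgt0 // => M0 H.
exists x; split=> // -[s [ps ls]]; apply: H; exists (map f s).
rewrite last_map ls path_map; split=> //; apply: sub_path ps => u v /= h.
have [uX vX] := mX _ _ _ M0 h.
by rewrite Mf // ler_pM2l.
Qed.

Lemma SC_eq P P' (c : int) : wf_profile P -> wf_profile P' -> pX P' = pX P ->
  0 < c -> (forall a b, Margin P' a b = c * Margin P a b) -> SC P = SC P'.
Proof.
move=> wfP wfP' eX c0 Mc; apply/fsetP => y.
have [yX|yX] := boolP (y \in pX P).
  apply: (SC_Margin_map (f := id)) => //; last by exists c.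
  by rewrite imfset_id eX.
by rewrite !in_SC eX (negbTE yX).
Qed.

Lemma count_fsetU1 (A : {fset Vt}) v (p : pred Vt) :
  v \notin A -> count p (v |` A) = (p v + count p A)%N.
Proof.
move=> vA; rewrite -[RHS]/(count p (v :: A)); apply/permP; apply: uniq_perm => //=.
  by rewrite vA fset_uniq.
by move=> w; rewrite !inE.
Qed.

Lemma n_above_add P P' v0 a b : adds_voter P P' v0 ->
  n_above P' a b = (ranks P' v0 a b + n_above P a b)%N.
Proof.
move=> [v0P VP _ RP]; rewrite !n_aboveE VP count_fsetU1 //; congr (_ + _)%N.
by apply: eq_in_count => v vP; rewrite RP.
Qed.

Lemma SC_anonymity : Anonymity (@SC Vt Xt).
Proof.
move=> P P' pi wfP wfP' eV eX pinj pV R; apply: (SC_eq (c := 1)) => // a b.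
rewrite mul1r; suff n c d : n_above P' c d = n_above P c d by rewrite /Margin !n.
rewrite !n_aboveE eV.
transitivity (count (fun v => ranks P v c d) (map pi (Defs.pV P))).
  by rewrite count_map; apply: eq_in_count => v /R /= ->.
apply/permP/perm_map_self; rewrite ?fset_uniq //.
Qed.

Lemma SC_neutrality : Neutrality (@SC Vt Xt).
Proof.
move=> P P' pi wfP wfP' eV eX pinj piX R x xX.
suff -> : (x \in SC P) = (pi x \in SC P') by [].
apply: SC_Margin_map => //.
  rewrite eX; apply/eqP; rewrite eqEfcard card_in_imfset ?leqnn ?andbT //.
  by apply/fsubsetP => w /imfsetP [z /= zX ->]; apply: piX.
exists 1 => // a b aX bX; rewrite mul1r.
have n c d : c \in pX P -> d \in pX P -> n_above P' (pi c) (pi d) = n_above P c d.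
  by move=> cX dX; rewrite !n_aboveE eV; apply: eq_in_count => v vP; rewrite R.
by rewrite /Margin !n.
Qed.

Lemma n_above_double P P' a b : is_double P P' ->
  n_above P' a b = (2 * n_above P a b)%N.
Proof.
move=> [_ [f [fV f2 fR]]]; rewrite !n_aboveE.
rewrite (eq_in_count (a2 := fun w => ranks P (f w) a b)) => [|w wP]; last by rewrite fR.
rewrite -!sum1_count big_mkcond /=.
(* Double counting of the pairs formed by a copy [w] and its original [f w]. *)
transitivity (\sum_(w <- pV P') \sum_(v <- pV P) (if f w == v then (ranks P v a b : nat) else 0))%N.
  rewrite big_seq [RHS]big_seq; apply: eq_bigr => w /fV fwP.
  rewrite (bigD1_seq (f w)) ?fset_uniq //= eqxx big1 ?addn0; last first.
    by move=> v; rewrite eq_sym => /negbTE ->.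
  by case: ranks.
rewrite exchange_big /= big_distrr /= [RHS]big_mkcond /= big_seq [RHS]big_seq.
apply: eq_bigr => v /f2; rewrite fset_count -sum1_count => f2v.
case: ranks; last by rewrite big1 // => w _; case: ifP.
by rewrite -big_mkcond muln1 f2v.
Qed.

Lemma SC_homogeneity : Homogeneity (@SC Vt Xt).
Proof.
move=> P P' wfP wfP' dbl; apply: (SC_eq (c := 2)) => //; first by case: dbl.
by move=> a b; rewrite /Margin !(n_above_double _ _ dbl); lia.
Qed.

Lemma SC_neutral_indifference : Neutral_Indifference (@SC Vt Xt).
Proof.
move=> P P' v0 wfP wfP' add R; apply: (SC_eq (c := 1)) => //; first by case: add.
by move=> a b; rewrite /Margin !(n_above_add _ _ add) !(negbTE (R _ _)) mul1r.
Qed.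

Lemma SC_neutral_reversal : Neutral_Reversal (@SC Vt Xt).
Proof.
move=> P P' v1 v2 wfP wfP' v1P v2P v12 VP XP R rev; apply: (SC_eq (c := 1)) => // a b.
have n c d : n_above P' c d = (ranks P' v1 c d + (ranks P' v1 d c + n_above P c d))%N.
  rewrite !n_aboveE VP !count_fsetU1 // ?rev; last by rewrite !inE negb_or v12.
  by do 2!congr (_ + _)%N; apply: eq_in_count => v vP; rewrite R.
by rewrite /Margin !n; lia.
Qed.

(** The move either breaks a tie with [x'] or joins the class of [x']. In both cases [x'], whose
    comparison with [y] is unchanged, is the middle term for transitivity and negative
    transitivity. *)
Lemma moved_up_ranks (X : {fset Xt}) (r r' : rel Xt) x y :
  strict_weak_order X r -> strict_weak_order X r' -> moved_up X r r' x ->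
  y \in X -> y != x -> (r x y -> r' x y) /\ (r' y x -> r y x).
Proof.
move=> [irr tr ntr] [irr' tr' ntr'] [xX [x' [[x'X x'x nxx' x'min] off tie untie]]] yX yx.
have asym' a b : a \in X -> b \in X -> r' a b -> ~~ r' b a.
  by move=> aX bX ab; apply/negP => ba; have := irr' a aX; rewrite (tr' _ _ _ aX bX aX ab ba).
have [xt|xnt] := boolP (tied r x x').
  have [nt xx' up] := tie xt; have /andP [_ nx'x] := xt.
  have low : r x' y -> r' x y.
    by move=> x'y; apply: (tr' _ x') => //; rewrite off.
  split=> [xy|yx'].
    apply: low; apply/negPn/negP => nx'y.
    by have := ntr _ _ _ xX x'X yX nxx' nx'y; rewrite xy.
  apply/negPn/negP => nryx.
  have : r' y x' by apply: (tr' _ x).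
  rewrite off // => ryx'.
  by have := ntr _ _ _ yX xX x'X nryx nxx'; rewrite ryx'.
(* Now [x'] is strictly above [x]. A candidate tied with [x] would contradict the minimality of
   [x'], so the second clause of [moved_up] applies. *)
have x'x_ : r x' x by move: xnt; rewrite /tied nxx' /= negbK.
have nt z : z \in X -> z != x -> ~~ tied r x z.
  move=> zX zx; apply/negP => /andP [nxz nzx].
  have nx'z := x'min z zX zx nxz.
  by have := ntr _ _ _ x'X zX xX nx'z nzx; rewrite x'x_.
have /andP [nxx'2 nx'x2] := untie nt.
split=> [xy|yx2].
  have x'y : r' x' y by rewrite off // (tr _ x).
  apply/negPn/negP => nxy.
  by have := ntr' _ _ _ x'X xX yX nx'x2 nxy; rewrite x'y.
apply/negPn/negP => nryx.
have xy : r x y by have := nt y yX yx; rewrite /tied nryx andbT negbK.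
have x'y : r' x' y by rewrite off // (tr _ x).
have : r' x' x by apply: (tr' _ y).
by apply/negP.
Qed.

Lemma moves_up_Margin P P' x : wf_profile P -> wf_profile P' -> moves_up_one P P' x ->
  (forall y, Margin P x y <= Margin P' x y) /\
  (forall a b, a != x -> b != x -> Margin P' a b = Margin P a b).
Proof.
move=> wfP wfP' [eV [eX [v [vP mv off]]]].
have [_ _ memR swo] := wfP; have [_ _ memR' swo'] := wfP'.
have swo2 : strict_weak_order (pX P) (ranks P' v) by rewrite -eX; apply: swo'; rewrite eV.
have mono y : y != x -> (n_above P x y <= n_above P' x y)%N /\ (n_above P' y x <= n_above P y x)%N.
  move=> yx.
  have [yX|yX] := boolP (y \in pX P); last first.
    have z (Q : profile Vt Xt) c d : pX Q = pX P -> wf_profile Q -> (c == y) || (d == y) -> n_above Q c d = 0%N.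
      move=> eXQ [_ _ mR _] cd; apply/eqP; rewrite n_aboveE -leqn0 leqNgt -has_count.
      apply/negP => /hasP [w _ /mR [_ cX dX]].
      by move: yX; rewrite -eXQ; case/orP: cd => /eqP <-; rewrite ?cX ?dX.
    by rewrite !(z P) ?(z P') // eqxx ?orbT.
  have [m1 m2] := moved_up_ranks (swo v vP) swo2 mv yX yx.
  rewrite !n_aboveE !eV; split.
    apply: sub_in_count => w wP; have [->//|wv] := eqVneq w v.
    by rewrite off.
  apply: sub_in_count => w wP; have [->//|wv] := eqVneq w v.
  by rewrite off.
split=> [y|a b ax bx].
  have [->|/mono [h1 h2]] := eqVneq y x; first by rewrite !Marginxx.
  by rewrite /Margin; lia.
have n c d : c != x -> d != x -> n_above P' c d = n_above P c d.
  move=> cx dx; rewrite !n_aboveE eV; apply: eq_in_count => w wP.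
  have [->|wv] := eqVneq w v; last by rewrite off.
  case: mv => _ [x' [_ offx _ _]].
  have [cX|cX] := boolP (c \in pX P); last first.
    by apply/idP/idP => [/memR' [_]|/memR [_]]; rewrite ?eX (negbTE cX).
  have [dX|dX] := boolP (d \in pX P); last first.
    by apply/idP/idP => [/memR' [_ _]|/memR [_ _]]; rewrite ?eX (negbTE dX).
  exact: offx.
by rewrite /Margin !n.
Qed.

Lemma reach_uniq (M : Xt -> Xt -> int) k a b : reach M k a b ->
  exists s, [/\ path (fun a b => k <= M a b) a s, last a s = b & uniq (a :: s)].
Proof. by move=> [s [ps ls]]; case/shortenP: ps ls => t pt ut _ lt; exists t. Qed.

(** A defeat of [x] after the move was there before: the margin over [x] was at least as large, and
    a simple path from [x] leaves it once, along an edge that can only grow, and then avoids it. *)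
Lemma SC_monotonicity : Monotonicity (@SC Vt Xt).
Proof.
move=> P P' x wfP wfP' mv xF.
have xX : x \in pX P by move: xF; rewrite in_SC => /andP [].
have eX : pX P' = pX P by case: mv => _ [].
have xX' : x \in pX P' by rewrite eX.
have [Mx Moff] := moves_up_Margin wfP wfP' mv.
apply: contraLR xF => /(not_in_SC wfP' xX') [z [M0 H]].
apply/(not_in_SC wfP xX); exists z.
have Mz : Margin P' z x <= Margin P z x by rewrite MarginC [Margin P z x]MarginC lerN2.
split; first exact: lt_le_trans Mz.
move=> /(reach_le Mz) /reach_uniq [s [ps ls us]]; apply: H; exists s; split=> //.
move: ps us; case: s {ls} => //= b s /andP [xb bs] /and3P [xbs _ _].
rewrite (le_trans xb (Mx b)) /=.
elim: s b bs xbs {xb} => //= c s IH b /andP [bc cs].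
rewrite !inE !negb_or => /and3P [xb xc xs].
by rewrite (Moff b c) 1?eq_sym // bc IH // inE negb_or xc.
Qed.

(** The witness is a candidate that defeats [y]. Its margin over [y] is fixed by the ballots on the
    two, and every positive edge of [P'] was at least as strong in [P], so no new path back to it
    arises. *)
Lemma SC_coherent_IIA : Coherent_IIA (@SC Vt Xt).
Proof.
move=> P y wfP yF.
have [yX|yX] := boolP (y \in pX P); last first.
  have [_ /fset0Pn [x xX] _ _] := wfP; exists x; split=> // P' _ [[_ _ yX' sX] _ _].
  by move/fsubsetP/(_ y yX'): sX; rewrite (negbTE yX).
move/(not_in_SC wfP yX): yF => [x [M0 H]].
exists x; split; first by case: (Margin_gt0_mem wfP M0).
move=> P' wfP' [[eV xX' yX' sX] R M].
apply/(not_in_SC wfP' yX'); exists x.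
have Mxy a b : a \in [fset x; y] -> b \in [fset x; y] -> Margin P' a b = Margin P a b.
  move=> aS bS; rewrite /Margin !n_aboveE eV.
  by congr (_%:Z - _%:Z); apply: eq_in_count => v vP; rewrite R.
have xS : x \in [fset x; y] by rewrite !inE eqxx.
have yS : y \in [fset x; y] by rewrite !inE eqxx orbT.
rewrite Mxy //; split=> // -[s [ps ls]]; apply: H; exists s; split=> //.
apply: sub_path ps => a b h.
have h0 := lt_le_trans M0 h.
have [aX bX] := Margin_gt0_mem wfP' h0.
have [/andP [aS bS]|nS] := boolP ((a \in [fset x; y]) && (b \in [fset x; y])).
  by rewrite -(Mxy a b).
have [|_] := M a b aX bX _ h0; first by move=> [aS bS]; rewrite aS bS in nS.
exact: le_trans.
Qed.

Lemma SC_coherent_defeat : Coherent_Defeat (@SC Vt Xt).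
Proof.
move=> P x y wfP M0 nopath; rewrite in_SC negb_and; apply/orP; right.
apply/pdecP => -[]; exists x; split=> // s ps.
by case: nopath; exists s.
Qed.

(** If [z] defeats [x] afterwards, the new voter must rank [x] above [z], so the margin of [z] over
    [x] fell by exactly 1. Other margins fell by at most 1, so a path that blocked the defeat before
    would still block it. *)
Lemma SC_tolerant_positive_involvement : Tolerant_Positive_Involvement (@SC Vt Xt).
Proof.
move=> P P' v0 x wfP wfP' xF add top.
have xX : x \in pX P by move: xF; rewrite in_SC => /andP [].
have [v0P eV eX _] := add.
have xX' : x \in pX P' by rewrite eX.
have M' a b : Margin P' a b = Margin P a b + (ranks P' v0 a b)%:Z - (ranks P' v0 b a)%:Z.
  by rewrite /Margin !(n_above_add _ _ add); lia.
apply: contraLR xF => /(not_in_SC wfP' xX') [z [M0 H]].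
apply/(not_in_SC wfP xX); exists z.
have zx : z != x by apply/eqP => zx; move: M0; rewrite zx Marginxx.
have [zX' _] := Margin_gt0_mem wfP' M0.
have nmaj : ~~ maj_pref P x z.
  by rewrite /maj_pref; move: M0; rewrite M' [Margin P x z]MarginC; lia.
have vxz : ranks P' v0 x z by apply: top; rewrite -?eX.
have nvzx : ~~ ranks P' v0 z x.
  have [_ _ _ /(_ v0)] := wfP'; rewrite eV !inE eqxx => /(_ isT) [irr tr _].
  by apply/negP => vzx; have := irr x xX'; rewrite (tr x z x).
have Mz : Margin P' z x = Margin P z x - 1 by rewrite M' vxz (negbTE nvzx); lia.
split; first by lia.
move=> [s [ps ls]]; apply: H; exists s; split=> //; apply: sub_path ps => a b.
by rewrite Mz M'; lia.
Qed.

End Margins.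

(** * Profiles given by lists of voters and ballots *)

Section Ballots.
Variables Xt : choiceType.
Implicit Types (X Y : {fset Xt}) (a c x y z : Xt).

Definition ballot := {fset Xt * Xt}.
Implicit Types b : ballot.

Definition wf_ballot X b :=
  (forall a c, (a, c) \in b -> a \in X /\ c \in X) /\
  strict_weak_order X (fun a c => (a, c) \in b).

Lemma wf_ballot_asym X b a c : wf_ballot X b -> ~~ (((a, c) \in b) && ((c, a) \in b)).
Proof.
move=> [inX [irr tr _]]; apply/negP => /andP [ac ca].
have [aX cX] := inX _ _ ac.
by have := irr a aX; rewrite (tr a c a).
Qed.

(** Higher scores are ranked above. Any score gives a strict weak order, so ballots built this way
    need no further check. *)
Definition score_ballot X (r : Xt -> nat) : ballot :=
  [fset p in X `*` X | (r p.2 < r p.1)%N].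

Lemma in_score_ballot X r a c :
  ((a, c) \in score_ballot X r) = [&& a \in X, c \in X & (r c < r a)%N].
Proof. by rewrite !inE /= andbA. Qed.

Lemma wf_score_ballot X r : wf_ballot X (score_ballot X r).
Proof.
split; first by move=> a c; rewrite in_score_ballot => /and3P [].
split=> [a aX|a c z aX cX zX|a c z aX cX zX]; rewrite !in_score_ballot ?aX ?cX ?zX ?ltnn //=;
  lia.
Qed.

Lemma wf_ballot0 X : wf_ballot X fset0.
Proof. by split=> [a c|]; [rewrite inE | split=> *; rewrite ?inE]. Qed.

Definition converse b : ballot := [fset (p.2, p.1) | p in b].

Lemma in_converse b a c : ((a, c) \in converse b) = ((c, a) \in b).
Proof.
apply/imfsetP/idP => [[[u v] /= uv [-> ->]] //|ca].
by exists (c, a).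
Qed.

Lemma wf_converse X b : wf_ballot X b -> wf_ballot X (converse b).
Proof.
move=> [inX [irr tr ntr]]; split.
  by move=> a c; rewrite in_converse => /inX [].
split=> [a aX|a c z aX cX zX|a c z aX cX zX]; rewrite !in_converse.
- exact: irr.
- by move=> ca zc; apply: tr zc ca.
- by move=> ca zc; apply: ntr zc ca.
Qed.

Lemma converse0 : converse fset0 = fset0.
Proof. by apply/fsetP => -[a c]; rewrite in_converse !inE. Qed.

Definition relabel (f : Xt -> Xt) b : ballot := [fset (f p.1, f p.2) | p in b].

Lemma in_relabel f b a c : injective f -> ((f a, f c) \in relabel f b) = ((a, c) \in b).
Proof.
move=> fi; apply/imfsetP/idP => [[[u v] /= uv [/fi -> /fi ->]] //|ac].
by exists (a, c).
Qed.

Definition restrict Y b : ballot := [fset p in b | (p.1 \in Y) && (p.2 \in Y)].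

Lemma in_restrict Y b a c :
  ((a, c) \in restrict Y b) = [&& (a, c) \in b, a \in Y & c \in Y].
Proof. by rewrite !inE. Qed.

Lemma wf_restrict X Y b : Y `<=` X -> wf_ballot X b -> wf_ballot Y (restrict Y b).
Proof.
move=> /fsubsetP YX [inX [irr tr ntr]]; split.
  by move=> a c; rewrite in_restrict => /and3P [].
by split=> [a aY|a c z aY cY zY|a c z aY cY zY]; rewrite !in_restrict ?aY ?cY ?zY ?andbT /=;
  [apply: irr | apply: tr | apply: ntr]; apply: YX.
Qed.

Definition pro a c (bs : seq ballot) : nat := count (fun b => (a, c) \in b) bs.

Lemma pro_cat a c bs1 bs2 : pro a c (bs1 ++ bs2) = (pro a c bs1 + pro a c bs2)%N.
Proof. exact: count_cat. Qed.

Lemma pro_nseq a c n b : pro a c (nseq n b) = (((a, c) \in b) * n)%N.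
Proof. exact: count_nseq. Qed.

Lemma perm_pro a c bs bs' : perm_eq bs bs' -> pro a c bs = pro a c bs'.
Proof. by rewrite /pro => /permP ->. Qed.

Definition code a c b : bool * bool := ((a, c) \in b, (c, a) \in b).

(** Asymmetry excludes the code [(true, true)]. The two strict codes are counted by [pro], and the
    number of ties is what remains of the size. *)
Lemma perm_code X X' a c bs bs' :
  (forall b, b \in bs -> wf_ballot X b) -> (forall b, b \in bs' -> wf_ballot X' b) ->
  size bs = size bs' -> pro a c bs = pro a c bs' -> pro c a bs = pro c a bs' ->
  perm_eq (map (code a c) bs) (map (code a c) bs').
Proof.
move=> wf wf' sz ac ca; apply/allP => p _ /=; rewrite !count_map; apply/eqP.
have tt (Z : {fset Xt}) (l : seq ballot) : (forall b, b \in l -> wf_ballot Z b) ->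
    [/\ count (preim (code a c) (pred1 (true, true))) l = 0%N,
        count (preim (code a c) (pred1 (true, false))) l = pro a c l,
        count (preim (code a c) (pred1 (false, true))) l = pro c a l
      & (count (preim (code a c) (pred1 (false, false))) l + pro a c l + pro c a l)%N = size l].
  elim: l => // b l IH wfl.
  have [|h1 h2 h3 h4] := IH; first by move=> d dl; apply: wfl; rewrite inE dl orbT.
  have /(wf_ballot_asym a c) : wf_ballot Z b by apply: wfl; rewrite mem_head.
  move: h1 h2 h3 h4; rewrite /pro /code /=.
  by case: ((a, c) \in b); case: ((c, a) \in b) => //= ? ? ? ? _; split; lia.
have [h1 h2 h3 h4] := tt _ _ wf; have [k1 k2 k3 k4] := tt _ _ wf'.
case: p => -[] []; [by rewrite h1 k1|by rewrite h2 k2|by rewrite h3 k3|].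
by move: h4; rewrite sz -k4 ac ca => /addIn /addIn.
Qed.

Definition pairs k b : seq ballot := flatten (nseq k [:: b; converse b]).

Lemma size_pairs k b : size (pairs k b) = (k + k)%N.
Proof. by elim: k => //= k; rewrite /pairs /= => ->; rewrite addnS. Qed.

Lemma pro_pairs a c k b : pro a c (pairs k b) = (k * (((a, c) \in b) + ((c, a) \in b)))%N.
Proof.
elim: k => //= k IH; rewrite [LHS](pro_cat a c [:: b; converse b] (pairs k b)) IH.
by rewrite /pro /= in_converse mulSn addn0.
Qed.

Lemma mem_pairs k b d : d \in pairs k b -> d = b \/ d = converse b.
Proof.
elim: k => //= k IH; rewrite /pairs /= !inE => /or3P [/eqP|/eqP|]; by [left | right | ].
Qed.

End Ballots.

Section ListProfiles.
Variables Vt Xt : choiceType.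
Implicit Types (X : {fset Xt}) (a c x y z : Xt) (b : ballot Xt) (bs : seq (ballot Xt)).
Implicit Types (v w : Vt) (vs ws : seq Vt).

(** Profiles become lists that can be concatenated and, under Anonymity, permuted. *)
Definition prof vs X bs : profile Vt Xt :=
  Profile [fset v in vs] X
    [fset t in [seq (v, p.1, p.2) | v <- vs, p <- enum_fset (nth fset0 bs (index v vs))]].

Lemma ranks_prof vs X bs v a c :
  ranks (prof vs X bs) v a c = (v \in vs) && ((a, c) \in nth fset0 bs (index v vs)).
Proof.
rewrite /ranks /= inE /=; apply/allpairsPdep/andP => [[w [[u z] /= [wv uz [-> -> ->]]]] //|[vv ac]].
by exists v, (a, c).
Qed.

Lemma mem_pV_prof vs X bs v : (v \in pV (prof vs X bs)) = (v \in vs).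
Proof. by rewrite /= inE. Qed.

Definition wf_lists vs X bs :=
  [/\ uniq vs, size bs = size vs, (0 < size vs)%N, X != fset0
    & forall b, b \in bs -> wf_ballot X b].

Lemma mem_nth_index vs bs v : size bs = size vs -> v \in vs ->
  nth fset0 bs (index v vs) \in bs.
Proof. by move=> sz vv; rewrite mem_nth // sz index_mem. Qed.

Lemma wf_prof vs X bs : wf_lists vs X bs -> wf_profile (prof vs X bs).
Proof.
move=> [uv sz n0 X0 wf]; split=> //.
- case: vs n0 {uv sz wf} => // v vs _.
  by apply/fset0Pn; exists v; rewrite mem_pV_prof mem_head.
- move=> v a c; rewrite ranks_prof mem_pV_prof => /andP [vv ac].
  by have [/(_ _ _ ac) []] := wf _ (mem_nth_index sz vv).
move=> v; rewrite mem_pV_prof => vv.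
have [_ [irr tr ntr]] := wf _ (mem_nth_index sz vv).
split=> [a aX|a c z aX cX zX|a c z aX cX zX]; rewrite !ranks_prof vv /=;
  by [apply: irr | apply: tr | apply: ntr].
Qed.

Lemma n_above_prof vs X bs a c : uniq vs -> size bs = size vs ->
  n_above (prof vs X bs) a c = pro a c bs.
Proof.
move=> uv sz; rewrite n_aboveE.
transitivity (count (fun v => (a, c) \in nth fset0 bs (index v vs)) vs).
  transitivity (count (fun v => ranks (prof vs X bs) v a c) vs); last first.
    by apply: eq_in_count => v vv; rewrite ranks_prof vv.
  apply/permP; apply: uniq_perm; rewrite ?fset_uniq // => v.
  exact: mem_pV_prof.
rewrite /pro -(count_map (fun v => nth fset0 bs (index v vs)) (fun b => (a, c) \in b)).
congr count; apply: (eq_from_nth (x0 := fset0)); rewrite size_map // => i ivs.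
case: vs uv sz ivs => // v vs uv sz ivs.
by rewrite (nth_map v) // index_uniq.
Qed.

Lemma Margin_prof vs X bs a c : uniq vs -> size bs = size vs ->
  Margin (prof vs X bs) a c = (pro a c bs)%:Z - (pro c a bs)%:Z.
Proof. by move=> uv sz; rewrite /Margin !n_above_prof. Qed.

Lemma wf_profile_prof (P : profile Vt Xt) : wf_profile P ->
  exists vs bs, wf_lists vs (pX P) bs /\ P = prof vs (pX P) bs.
Proof.
move=> [V0 X0 memR swo]; pose vs := enum_fset (pV P).
pose bal v : ballot Xt := [fset p in pX P `*` pX P | ranks P v p.1 p.2].
have in_bal v a c : ((a, c) \in bal v) = ranks P v a c.
  rewrite !inE /=; case R: (ranks P v a c); rewrite ?andbF // andbT.
  by have [_ -> ->] := memR _ _ _ R.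
exists vs, (map bal vs); split.
  split; rewrite ?fset_uniq ?size_map //.
    case/fset0Pn: V0 => v vP; have : v \in vs by [].
    by case: (vs).
  move=> b /mapP [v vP ->]; split; first by move=> a c; rewrite in_bal => /memR [].
  by have [irr tr ntr] := swo v vP;
    split=> [a aX|a c z aX cX zX|a c z aX cX zX]; rewrite !in_bal;
    [apply: irr | apply: tr | apply: ntr].
case: P V0 X0 memR swo @vs @bal in_bal => V X R V0 X0 memR swo vs bal in_bal.
have E1 : [fset v in vs] = V by apply/fsetP => v; rewrite inE.
rewrite /prof E1; congr Profile; apply/fsetP => -[[v a] c].
have -> : ((v, a, c) \in R) = ranks (Profile V X R) v a c by [].
have -> : forall A, ((v, a, c) \in A) = ranks (Profile V X A) v a c by [].
rewrite -[RHS]/(ranks (prof vs X (map bal vs)) v a c) ranks_prof.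
have [vv|nv] := boolP (v \in vs).
  by rewrite (nth_map v) ?index_mem // nth_index // in_bal.
by apply/idP => /memR [vV _ _]; rewrite /vs vV in nv.
Qed.

Lemma fresh_voters n vs : infinite_type Vt -> uniq vs ->
  exists2 ws, size ws = n & uniq (ws ++ vs).
Proof.
move=> inf uv; elim: n => [|n [ws <- uw]]; first by exists [::].
have [v] := inf [fset w in ws ++ vs]; rewrite !inE /= -mem_cat => nv.
by exists (v :: ws); rewrite //= nv.
Qed.

Variable F : VSCC Vt Xt.

Lemma perm_prof vs X bs bs' : Anonymity F -> wf_lists vs X bs -> perm_eq bs bs' ->
  F (prof vs X bs) = F (prof vs X bs').
Proof.
move=> anon wfl p; have [uv sz n0 X0 wf] := wfl.
have wfl' : wf_lists vs X bs'.
  by split=> //; [rewrite -(perm_size p) | move=> b; rewrite -(perm_mem p); apply: wf].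
have /(perm_iotaP fset0) [Is pI eb] : perm_eq bs' bs by rewrite perm_sym.
have sI : size Is = size vs by rewrite (perm_size pI) size_iota.
have lI i : i \in Is -> (i < size vs)%N by rewrite (perm_mem pI) mem_iota sz.
have uI : uniq Is by rewrite (perm_uniq pI) iota_uniq.
(* Position [i] of [bs'] holds the ballot at position [nth 0 Is i] of [bs]; [pi] sends a voter to
   the one who cast this ballot before. *)
pose pi v := nth v vs (nth 0%N Is (index v vs)).
have iI v : v \in vs -> nth 0%N Is (index v vs) \in Is.
  by move=> vv; rewrite mem_nth // sI index_mem.
apply: (anon _ _ pi); rewrite ?mem_pV_prof //; try exact: wf_prof.
- move=> v w; rewrite !mem_pV_prof => vv wv; rewrite /pi.
  rewrite (set_nth_default w) ?lI ?iI // => /eqP; rewrite nth_uniq ?lI ?iI //.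
  by rewrite nth_uniq ?sI ?index_mem // => /eqP /(congr1 (nth v vs)); rewrite !nth_index.
- by move=> v; rewrite !mem_pV_prof => vv; rewrite mem_nth ?lI ?iI.
move=> v a c; rewrite mem_pV_prof => vv; rewrite !ranks_prof vv.
have piv : pi v \in vs by rewrite mem_nth ?lI ?iI.
by rewrite piv /pi index_uniq ?lI ?iI // eb (nth_map 0%N) // sI index_mem.
Qed.

Lemma reversal_prof vs X bs v1 v2 b : Neutral_Reversal F -> wf_lists vs X bs ->
  uniq [:: v1, v2 & vs] -> wf_ballot X b ->
  F (prof [:: v1, v2 & vs] X [:: b, converse b & bs]) = F (prof vs X bs).
Proof.
move=> nr wfl u wfb; have [uv sz n0 X0 wf] := wfl.
have /= /andP [] := u; rewrite inE negb_or => /andP [v12 v1s] /andP [v2s _].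
symmetry; apply: (nr _ _ v1 v2); rewrite ?mem_pV_prof //; try exact: wf_prof.
- apply: wf_prof; split; rewrite //= ?sz //.
  by move=> d; rewrite !inE => /or3P [/eqP ->|/eqP ->|/wf //] //; apply: wf_converse.
- by apply/fsetP => v; rewrite !inE.
- move=> v a c; rewrite mem_pV_prof => vv; rewrite !ranks_prof !inE vv !orbT /=.
  have [e|_] := eqVneq v1 v; first by rewrite e vv in v1s.
  by have [e|_] := eqVneq v2 v; first by rewrite e vv in v2s.
- move=> a c; rewrite !ranks_prof !inE !eqxx ?orbT /= eqxx (negbTE v12) /= in_converse.
  by rewrite eqxx.
Qed.

Lemma pairs_prof vs ws X bs k b : Neutral_Reversal F -> wf_lists vs X bs ->
  uniq (ws ++ vs) -> size ws = (k + k)%N -> wf_ballot X b ->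
  F (prof (ws ++ vs) X (pairs k b ++ bs)) = F (prof vs X bs).
Proof.
move=> nr wfl u sw wfb; elim: k ws u sw => [|k IH] [|v1 [|v2 ws]] //.
  by rewrite addnS.
move=> u sw; have sw' : size ws = (k + k)%N by move: sw => /=; lia.
have uw : uniq (ws ++ vs) by case/andP: u => _ /andP [].
rewrite -(IH ws) // -[pairs k.+1 b]/([:: b, converse b & pairs k b]) /=.
apply: reversal_prof => //; have [uv sz n0 X0 wf] := wfl; split=> //.
- by rewrite !size_cat size_pairs sz sw'.
- by rewrite size_cat; lia.
move=> d; rewrite mem_cat => /orP [/mem_pairs [->|->]|/wf] //.
exact: wf_converse.
Qed.

(** Neutrality carries [z] to [f z] in the relabelled profile, whose ballots are the old ones in
    another order, so Anonymity leads back to the original profile. *)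
Lemma relabel_prof vs X bs (f : Xt -> Xt) z : Anonymity F -> Neutrality F ->
  wf_lists vs X bs -> injective f -> (forall a, a \in X -> f a \in X) ->
  perm_eq (map (relabel f) bs) bs -> z \in X ->
  (z \in F (prof vs X bs)) = (f z \in F (prof vs X bs)).
Proof.
move=> anon neut wfl fi fX p zX; have [uv sz n0 X0 wf] := wfl.
have wfl' : wf_lists vs X (map (relabel f) bs).
  by split; rewrite ?size_map // => b; rewrite (perm_mem p); apply: wf.
rewrite -[in RHS](perm_prof anon wfl' p).
suff N : z \in F (prof vs X bs) <-> f z \in F (prof vs X (map (relabel f) bs)).
  by apply/idP/idP => /N.
apply: neut; rewrite //; try exact: wf_prof; first by move=> a c _ _ /fi.
move=> v a c; rewrite mem_pV_prof => vv _ _.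
by rewrite !ranks_prof vv (nth_map fset0) ?sz ?index_mem // in_relabel.
Qed.

End ListProfiles.

(** * Two candidates, and cyclic profiles *)

Section TwoCandidates.
Variables (Vt Xt : choiceType) (F : VSCC Vt Xt) (x y : Xt).
Hypothesis xy : x != y.
Let X2 : {fset Xt} := [fset x; y].

Definition decode (p : bool * bool) : ballot Xt :=
  if p.1 then [fset (x, y)] else if p.2 then [fset (y, x)] else fset0.

Lemma codeK b : wf_ballot X2 b -> decode (code x y b) = b.
Proof.
move=> wfb; have asym := wf_ballot_asym x y wfb.
have [inX [irr _ _]] := wfb.
have irr' z : (z, z) \notin b.
  by apply/negP => zz; have [zX _] := inX _ _ zz; have := irr z zX; rewrite zz.
have xy' : (y, x) != (x, y) by rewrite xpair_eqE negb_and eq_sym xy.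
apply/fsetP => -[u v]; rewrite /decode /code /=.
have [uvb|uvb] := boolP ((u, v) \in b).
  have [] := inX _ _ uvb; rewrite !inE.
  case/orP => /eqP eu; case/orP => /eqP ev; move: uvb; rewrite eu ev ?(negbTE (irr' _)) // => uvb.
    by rewrite uvb inE eqxx.
  by move: asym; rewrite uvb andbT => /negbTE ->; rewrite inE eqxx.
case: ifP => [h|_]; last case: ifP => [h|_]; rewrite !inE //.
  by apply/negP => /eqP e; rewrite e h in uvb.
by apply/negP => /eqP e; rewrite e h in uvb.
Qed.

(** Induction on the lead of [y]. At a tie, swapping the candidates permutes the ballots. Otherwise
    one ballot for [y] is made indifferent, and Monotonicity restores it without losing [y]. *)
Lemma two_candidates vs bs : is_VSCC F -> Anonymity F -> Neutrality F ->
  Monotonicity_two F -> wf_lists vs X2 bs ->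
  (pro x y bs <= pro y x bs)%N -> y \in F (prof vs X2 bs).
Proof.
move=> vscc anon neut mono; move ed: (pro y x bs - pro x y bs)%N => d.
have xX : x \in X2 by rewrite !inE eqxx.
have yX : y \in X2 by rewrite !inE eqxx orbT.
have yx : y != x by rewrite eq_sym.
elim: d bs ed => [|d IH] bs ed wfl le_xy; have [uv sz n0 X0 wf] := wfl.
  have exy : pro x y bs = pro y x bs by lia.
  (* [next] fixes whatever lies outside the list, so this swap of [x] and [y] is injective on the
     whole type. *)
  pose f := next [:: x; y].
  have fx : f x = y by rewrite /f /= eqxx.
  have fy : f y = x by rewrite /f /= eqxx (negbTE yx).
  have u2 : uniq [:: x; y] by rewrite /= inE xy.
  have fi : injective f := can_inj (prev_next u2).
  have fX a : a \in X2 -> f a \in X2.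
    by rewrite !inE => /orP [] /eqP ->; rewrite ?fx ?fy eqxx ?orbT.
  have wfr b : b \in map (relabel f) bs -> wf_ballot X2 b.
    move=> /mapP [b0 /wf [inX [irr tr ntr]] ->].
    have ff z : f (f z) = z.
      rewrite /f /=; do !case: eqP => //=; congruence.
    have rE u v : ((u, v) \in relabel f b0) = ((f u, f v) \in b0).
      by rewrite -{1}(ff u) -{1}(ff v) in_relabel.
    split; first by move=> a c; rewrite rE => /inX [/fX h1 /fX h2]; rewrite -(ff a) -(ff c).
    by split=> [a aX|a c z aX cX zX|a c z aX cX zX]; rewrite !rE;
      [apply: irr|apply: tr|apply: ntr]; apply: fX.
  have p : perm_eq (map (relabel f) bs) bs.
    have pm u v : pro (f u) (f v) (map (relabel f) bs) = pro u v bs.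
      by rewrite /pro count_map; apply: eq_count => b /=; rewrite in_relabel.
    have pc : perm_eq (map (code x y) (map (relabel f) bs)) (map (code x y) bs).
      apply: (perm_code (X := X2) (X' := X2)); rewrite ?size_map //.
        by have := pm y x; rewrite fx fy => ->.
      by have := pm x y; rewrite fx fy => ->.
    have := perm_map decode pc; rewrite -!map_comp.
    have -> : [seq (decode \o (code x y \o relabel f)) i | i <- bs] = map (relabel f) bs.
      by apply/eq_in_map => b bb /=; apply: codeK; apply: wfr; apply: map_f.
    by rewrite (map_id_in (f := decode \o code x y)) // => b /wf /codeK.
  (* Some candidate wins; if it is [x], the swap makes [y] win as well. *)
  have [/fset0Pn [z zF] /fsubsetP sub] := vscc _ (wf_prof wfl).
  have /= := sub _ zF; rewrite !inE => /orP [] /eqP zz; last by rewrite -zz.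
  by rewrite -fx -(relabel_prof anon neut wfl) // -zz.
have [b bb byx] : exists2 b, b \in bs & (y, x) \in b.
  by apply/hasP; rewrite has_count -/(pro y x bs); lia.
have p := perm_to_rem bb; set bs1 := rem b bs in p.
have wfl2 : wf_lists vs X2 (b :: bs1).
  by split=> //; [rewrite -(perm_size p) | move=> c; rewrite -(perm_mem p); apply: wf].
have wfb := wf _ bb.
have bxy : (x, y) \notin b by have := wf_ballot_asym x y wfb; rewrite byx andbT.
have [inX [irr _ _]] := wfb.
have wfl1 : wf_lists vs X2 (fset0 :: bs1).
  case: wfl2 => _ sz2 _ _ wf2; split=> //.
  move=> c; rewrite inE => /orP [/eqP ->|cb]; first exact: wf_ballot0.
  by apply: wf2; rewrite inE cb orbT.
have pE u v : pro u v bs = (((u, v) \in b) + pro u v (fset0 :: bs1))%N.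
  by rewrite (perm_pro _ _ p) /pro /= ?inE.
rewrite (perm_prof anon wfl p).
have yF : y \in F (prof vs X2 (fset0 :: bs1)).
  have pyx : pro y x bs = (pro y x (fset0 :: bs1)).+1 by rewrite pE byx.
  have pxy : pro x y bs = pro x y (fset0 :: bs1) by rewrite pE (negbTE bxy).
  by rewrite pyx pxy in ed le_xy; apply: IH => //; lia.
have wP := wf_prof wfl1; have wP' := wf_prof wfl2.
apply: (mono _ _ _ wP wP') yF => /=; first by rewrite cardfs2 xy.
split=> //; split=> //; case: vs uv n0 {IH wfl wfl1 wfl2 sz wP wP'} => [|v vs] uv n0; first by case: n0.
exists v; rewrite mem_pV_prof mem_head; split=> //; last first.
  by move=> w u z _ wv; rewrite !ranks_prof /= eq_sym (negbTE wv).
have r0 u z : ranks (prof (v :: vs) X2 (fset0 :: bs1)) v u z = false.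
  by rewrite ranks_prof /= eqxx inE andbF.
have r1 u z : ranks (prof (v :: vs) X2 (b :: bs1)) v u z = ((u, z) \in b).
  by rewrite ranks_prof mem_head /= eqxx.
have X2x u : u \in X2 -> u != y -> u = x by rewrite !inE => /orP [/eqP ->|/eqP ->] //; rewrite eqxx.
(* On the indifferent ballot [y] is tied with [x], so the move breaks this tie and the clause for an
   untied candidate is vacuous. *)
split=> //; exists x; split.
- by split=> // *; rewrite r0.
- move=> u z uX zX /(X2x _ uX) -> /(X2x _ zX) ->; rewrite r0 r1.
  by apply/negbTE/irr.
- move=> _; split; last by move=> u _; rewrite r0.
    by move=> u uX /(X2x _ uX) ->; rewrite /tied !r1 byx.
  by rewrite r1.
by move=> /(_ x xX xy); rewrite /tied !r0.
Qed.

End TwoCandidates.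

Section CyclicProfile.
Variables (Vt Xt : choiceType) (F : VSCC Vt Xt).
Implicit Types (X : {fset Xt}) (a c u w z : Xt).

(** A variant of McGarvey's construction. Since the second ballot ties [a] and [c], the margin is 1
    rather than 2, which gives odd margins too. *)
Definition edge_ballots X a c : seq (ballot Xt) :=
  [:: score_ballot X (fun z => (z == a).*2 + (z == c))%N;
      score_ballot X (fun z => ~~ ((z == a) || (z == c)))].

Lemma pro_edge_ballots X u w a c : u != w -> a \in X -> c \in X ->
  (pro a c (edge_ballots X u w))%:Z - (pro c a (edge_ballots X u w))%:Z =
  ((a == u) && (c == w))%:Z - ((c == u) && (a == w))%:Z :> int.
Proof.
move=> uw aX cX; rewrite /pro /= !in_score_ballot aX cX /=.
have wu : w != u by rewrite eq_sym.
case: (eqVneq a u) => [->|au]; case: (eqVneq c u) => [->|cu];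
  rewrite ?(negbTE uw) ?(negbTE wu) //=;
  case: (eqVneq _ w) => //= ?; case: (eqVneq _ w) => //= ?.
Qed.

Lemma pro_flatten a c (bss : seq (seq (ballot Xt))) :
  pro a c (flatten bss) = sumn (map (pro a c) bss).
Proof. exact: count_flatten. Qed.

Definition cycle_ballots m (C : seq Xt) : seq (ballot Xt) :=
  flatten [seq flatten (nseq m (edge_ballots [fset z in C] c (next C c))) | c <- C].

Lemma size_cycle_ballots m C : size (cycle_ballots m C) = (2 * m * size C)%N.
Proof.
rewrite /cycle_ballots size_flatten /shape -map_comp.
rewrite (eq_map (g := fun=> (2 * m)%N)) => [|c /=].
  by elim: C => [|c C IH]; rewrite ?muln0 //= IH mulnS.
by rewrite size_flatten /shape map_nseq sumn_nseq mulnC.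
Qed.

Lemma wf_cycle_ballots m C b : b \in cycle_ballots m C -> wf_ballot [fset z in C] b.
Proof.
case/flattenP => _ /mapP [c _ ->] /flattenP [_ /nseqP [-> _]].
by rewrite !inE => /orP [] /eqP ->; apply: wf_score_ballot.
Qed.

(** Of the sum over the cycle, only the block starting at [a] counts for [a] over [c], and only the
    block starting at [c] counts against it. *)
Lemma pro_cycle_ballots m C a c : uniq C -> (forall z, z \in C -> z != next C z) ->
  a \in C -> c \in C ->
  (pro a c (cycle_ballots m C))%:Z - (pro c a (cycle_ballots m C))%:Z =
  m%:Z * ((c == next C a)%:Z - (a == next C c)%:Z) :> int.
Proof.
move=> uC nC aC cC.
have sumE (g : Xt -> nat) : sumn (map g C) = (\sum_(z <- C) g z)%N by rewrite sumnE big_map.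
have proE u v : pro u v (cycle_ballots m C) =
    (\sum_(z <- C) m * pro u v (edge_ballots [fset z in C] z (next C z)))%N.
  rewrite pro_flatten -map_comp sumE; apply: eq_bigr => z _ /=.
  by rewrite pro_flatten map_nseq sumn_nseq mulnC.
have one u v : u \in C ->
    \sum_(z <- C) ((u == z) && (v == next C z))%:Z = (v == next C u)%:Z :> int.
  move=> uin; rewrite (bigD1_seq u) //= eqxx big1 ?addr0 // => z.
  by rewrite eq_sym => /negbTE ->.
rewrite !proE !(big_morph _ PoszD (erefl (Posz 0))) -sumrB.
rewrite -(one a c aC) -(one c a cC) -sumrB mulr_sumr big_seq [RHS]big_seq.
apply: eq_bigr => z zC; rewrite !PoszM -mulrBr pro_edge_ballots //; first exact: nC.
all: by rewrite inE.
Qed.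

(** Rotation takes the block of the edge leaving [c] to the block of the edge leaving [next C c], so
    it merely permutes the blocks. *)
Lemma perm_cycle_ballots m C : uniq C ->
  perm_eq (map (relabel (next C)) (cycle_ballots m C)) (cycle_ballots m C).
Proof.
move=> uC; have fi : injective (next C) := can_inj (prev_next uC).
set f := next C.
have relS r r' : (forall z, r' (f z) = r z) ->
    relabel f (score_ballot [fset z in C] r) = score_ballot [fset z in C] r'.
  (* Every candidate is written as a value of [next C], which lets [in_relabel] apply. *)
  move=> rr; apply/fsetP => -[a c]; rewrite -(next_prev uC a) -(next_prev uC c).
  by rewrite in_relabel // !in_score_ballot !inE /= !mem_next !rr.
have relE c : map (relabel f) (edge_ballots [fset z in C] c (f c)) =
    edge_ballots [fset z in C] (f c) (f (f c)).
  by congr [:: _; _]; apply: relS => z; rewrite !(inj_eq fi).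
rewrite /cycle_ballots map_flatten -map_comp.
rewrite (eq_map (g := (fun c => flatten (nseq m (edge_ballots [fset z in C] c (f c)))) \o f)).
  rewrite map_comp; apply: perm_flatten; apply: perm_map.
  by apply: perm_map_self => // [a c _ _ /fi|a] //; rewrite mem_next.
by move=> c /=; rewrite map_flatten map_nseq relE.
Qed.

(** Some candidate wins, winning is invariant under [next C], and iterating [next C] from any entry
    runs through all of [C]. *)
Lemma cyclic_winners vs C bs y : is_VSCC F -> Anonymity F -> Neutrality F ->
  uniq C -> wf_lists vs [fset z in C] bs ->
  perm_eq (map (relabel (next C)) bs) bs -> y \in C ->
  y \in F (prof vs [fset z in C] bs).
Proof.
move=> vscc anon neut uC wfl p yC; set X := [fset z in C] in wfl *.
have fi : injective (next C) := can_inj (prev_next uC).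
have inX z : (z \in X) = (z \in C) by rewrite inE.
have fX z : z \in X -> next C z \in X by rewrite !inX mem_next.
have rotF z : z \in X -> (z \in F (prof vs X bs)) = (next C z \in F (prof vs X bs)).
  exact: relabel_prof.
have [/fset0Pn [z zF] /fsubsetP sub] := vscc _ (wf_prof wfl).
have zC : z \in C by rewrite -inX; apply: sub.
have [i s Cs] := rot_to zC.
have : fcycle (next C) (rot i C) by rewrite rot_cycle cycle_next.
rewrite Cs /= rcons_path => /andP [ps _].
have win a : (a \in X) && (a \in F (prof vs X bs)) ->
    (next C a \in X) && (next C a \in F (prof vs X bs)).
  by move=> /andP [aX aF]; rewrite fX // -rotF.
have zwin : (z \in X) && (z \in F (prof vs X bs)) by rewrite inX zC.
have : y \in z :: s by rewrite -Cs mem_rot.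
rewrite inE => /predU1P [-> //|ys].
by have /allP /(_ y ys) /andP [] := fpath_closed win ps zwin.
Qed.

End CyclicProfile.

(** * SC is contained in F *)

Section Refinement.
Variables (Vt Xt : choiceType) (F : VSCC Vt Xt).
Implicit Types (X : {fset Xt}) (a c x y z : Xt) (vs : seq Vt) (bs : seq (ballot Xt)).

Lemma iia_rel_prof vs X X' bs bs' x y : wf_lists vs X bs -> wf_lists vs X' bs' ->
  X' `<=` X -> x \in X' -> y \in X' ->
  map (code x y) bs' = map (code x y) bs ->
  (forall a c, a \in X' -> c \in X' -> ~ (a \in [fset x; y] /\ c \in [fset x; y]) ->
    0 < Margin (prof vs X' bs') a c ->
    0 < Margin (prof vs X bs) a c /\ Margin (prof vs X' bs') a c <= Margin (prof vs X bs) a c) ->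
  iia_rel (prof vs X bs) (prof vs X' bs') x y.
Proof.
move=> [uv sz n0 X0 wf] [_ sz' _ _ wf'] XX xX yX ecode M; split=> // v a c.
rewrite mem_pV_prof => vv; rewrite !ranks_prof vv /=.
have iv : (index v vs < size vs)%N by rewrite index_mem.
have [/wf wb /wf' wb'] := (mem_nth_index sz vv, mem_nth_index sz' vv).
have := congr1 (nth (code x y fset0) ^~ (index v vs)) ecode.
rewrite /= !(nth_map fset0) ?sz ?sz' // /code => -[e1 e2].
(* Codes do not record diagonal pairs; irreflexivity settles those. *)
have irr (Z : {fset Xt}) (b : ballot Xt) z : wf_ballot Z b -> (z, z) \in b = false.
  by move=> [inZ [ir _ _]]; apply/negP => zz; have [zZ _] := inZ _ _ zz; have := ir z zZ; rewrite zz.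
rewrite !inE => /orP [] /eqP -> /orP [] /eqP -> //.
  by rewrite (irr _ _ _ wb) (irr _ _ _ wb').
by rewrite (irr _ _ _ wb) (irr _ _ _ wb').
Qed.

Lemma wf_lists_restrict vs X Y bs : Y `<=` X -> Y != fset0 -> wf_lists vs X bs ->
  wf_lists vs Y (map (restrict Y) bs).
Proof.
move=> YX Y0 [uv sz n0 X0 wf]; split; rewrite ?size_map //.
by move=> b /mapP [b0 /wf wb ->]; apply: wf_restrict wb.
Qed.

Lemma pro_restrict Y bs a c : a \in Y -> c \in Y ->
  pro a c (map (restrict Y) bs) = pro a c bs.
Proof.
move=> aY cY; rewrite /pro count_map; apply: eq_count => b /=.
by rewrite in_restrict aY cY !andbT.
Qed.

Hypotheses (infV : infinite_type Vt) (vscc : is_VSCC F) (anon : Anonymity F)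
  (neut : Neutrality F) (rev : Neutral_Reversal F) (mono : Monotonicity_two F)
  (iia : Coherent_IIA F).

(** Deleting all other candidates is allowed by Coherent IIA, so [y] loses against [x] alone, which
    it could not do with at least as many supporters. *)
Lemma IIA_witness_pro vs X bs x y : wf_lists vs X bs -> x \in X -> y \in X ->
  (forall P', wf_profile P' -> iia_rel (prof vs X bs) P' x y -> y \notin F P') ->
  x != y /\ (pro y x bs < pro x y bs)%N.
Proof.
move=> wfl xX yX wit; pose Y : {fset Xt} := [fset x; y].
have YX : Y `<=` X by apply/fsubsetP => z; rewrite !inE => /orP [] /eqP ->.
have xY : x \in Y by rewrite !inE eqxx.
have yY : y \in Y by rewrite !inE eqxx orbT.
have Y0 : Y != fset0 by apply/fset0Pn; exists x.
have wflY := wf_lists_restrict YX Y0 wfl.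
have yF : y \notin F (prof vs Y (map (restrict Y) bs)).
  apply: wit; first exact: wf_prof.
  apply: iia_rel_prof => //; last by move=> a c aY cY [].
  rewrite -map_comp; apply: eq_map => b /=.
  by rewrite /code !in_restrict xY yY !andbT.
have xy : x != y.
  (* If [x = y], a single candidate is left, and it has to win. *)
  apply: contra yF => /eqP exy.
  have [/fset0Pn [z zF] /fsubsetP sub] := vscc (wf_prof wflY).
  by have /= := sub _ zF; rewrite !inE exy orbb => /eqP <-.
split=> //; rewrite ltnNge; apply: contra yF => le_xy.
by apply: two_candidates => //; rewrite !pro_restrict.
Qed.

(** The contradiction comes from a competing profile on the cycle with the same ballots on [x] and
    [y]. The two size bounds ensure that the given profile has enough ballots to match the cycle
    blocks, with room for padding. *)
Lemma cycle_blocks_exclusion vs X bs x y (m : nat) s :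
  wf_lists vs X bs ->
  (forall P', wf_profile P' -> iia_rel (prof vs X bs) P' x y -> y \notin F P') ->
  x != y -> pro x y bs = (m + pro y x bs)%N -> (0 < m)%N ->
  (2 * m * size (y :: s) <= pro x y bs)%N ->
  (2 * m * size (y :: s) + 2 * pro x y bs <= size bs)%N ->
  path (fun a c => m%:Z <= Margin (prof vs X bs) a c) y s -> last y s = x ->
  uniq (y :: s) -> False.
Proof.
move=> wfl wit xy proxy m0 big1 big2 ps ls uC; have [uv sz n0 X0 wf] := wfl.
set C := y :: s in big1 big2 uC; set P := prof vs X bs in wit ps.
have wfP : wf_profile P := wf_prof wfl.
have MP a c : Margin P a c = (pro a c bs)%:Z - (pro c a bs)%:Z by apply: Margin_prof.
have Mxy : Margin P x y = m%:Z by rewrite MP proxy PoszD addrK.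
have memX a c : m%:Z <= Margin P a c -> a \in X /\ c \in X.
  by move=> h; apply: (Margin_gt0_mem wfP (lt_le_trans _ h)).
have [xX yX] : x \in X /\ y \in X by apply: memX; rewrite Mxy.
have xC : x \in C by rewrite -ls mem_last.
have yC : y \in C by rewrite mem_head.
(* [x] is the last entry of [C], so the lookup of its successor runs past the tail and returns the
   default, the head [y]. *)
have nx : next C x = y.
  by rewrite next_nth xC /C -ls index_last // nth_default.
have edge a : a \in C -> a != x -> m%:Z <= Margin P a (next C a).
  (* The disjunct [a == x] takes care of the closing step from [x] to [y]. *)
  have cyc : cycle (fun a c => (a == x) || (m%:Z <= Margin P a c)) C.
    rewrite /C /= rcons_path ls eqxx andbT.
    by apply: sub_path ps => u w ->; rewrite orbT.
  by move=> /(next_cycle cyc) /orP [/eqP -> /eqP|->].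
(* So the cycle is longer than two, and the edge from [x] to [y] is not offset by one in the
   opposite direction. *)
have ny : next C y != x.
  apply/eqP => nyx; have := edge y yC; rewrite eq_sym xy nyx => /(_ isT).
  by rewrite MarginC Mxy; move: m0; clear; lia.
have nC a : a \in C -> a != next C a.
  move=> aC; have [->|ax] := eqVneq a x; first by rewrite nx.
  by apply/eqP => e; have := edge a aC ax; rewrite -e Marginxx; move: m0; clear; lia.
pose X' : {fset Xt} := [fset z in C].
have X'E z : (z \in X') = (z \in C) by rewrite !inE.
have sX : X' `<=` X.
  apply/fsubsetP => a; rewrite X'E => aC; have [-> //|ax] := eqVneq a x.
  by have [] := memX _ _ (edge a aC ax).
have [xX' yX'] : x \in X' /\ y \in X' by rewrite !X'E.
have X'0 : X' != fset0 by apply/fset0Pn; exists x.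
pose T := cycle_ballots m C.
have sT : size T = (2 * m * size C)%N := size_cycle_ballots m C.
have netT a c : a \in C -> c \in C -> (pro a c T)%:Z - (pro c a T)%:Z =
    m%:Z * ((c == next C a)%:Z - (a == next C c)%:Z) :> int.
  exact: pro_cycle_ballots.
have proT : pro x y T = (m + pro y x T)%N.
  have := netT x y xC yC; rewrite nx eqxx eq_sym (negbTE ny).
  by move: (pro x y T) (pro y x T); clear; lia.
have leT : (pro x y T <= size T)%N by apply: count_size.
(* [p] pairs supply the missing ballots with [x] above [y]. They add as many the other way, which
   fits because both profiles have margin [m] there; [q] indifferent ballots then fill up the size.
   The bounds keep both subtractions exact. *)
pose p := (pro x y bs - pro x y T)%N.
pose q := (size bs - size T - (p + p))%N.
pose b0 := score_ballot X' (fun z => z == y).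
pose bsT := T ++ nseq q (fset0 : ballot Xt).
pose bs2 := pairs p b0 ++ bsT.
have b0yx : (y, x) \in b0 by rewrite in_score_ballot yX' xX' eqxx (negbTE xy).
have b0xy : (x, y) \notin b0 by rewrite in_score_ballot yX' xX' eqxx (negbTE xy).
have pro2 a c : pro a c bs2 = (p * (((a, c) \in b0) + ((c, a) \in b0)) + pro a c T)%N.
  by rewrite /bs2 /bsT !pro_cat pro_pairs pro_nseq inE mul0n addn0.
have szT : size bs2 = (p + p + (size T + q))%N.
  by rewrite /bs2 /bsT !size_cat size_pairs size_nseq.
have sz2 : size bs2 = size bs.
  rewrite szT /q /p; move: big1 big2; rewrite -sT.
  by move: (size T) (size bs) (pro x y bs) (pro x y T) leT; clear; lia.
have wfT b : b \in bsT -> wf_ballot X' b.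
  rewrite mem_cat => /orP [/wf_cycle_ballots //|/nseqP [-> _]].
  exact: wf_ballot0.
have wf2 b : b \in bs2 -> wf_ballot X' b.
  rewrite mem_cat => /orP [/mem_pairs [] ->|/wfT //].
    exact: wf_score_ballot.
  by apply: wf_converse; apply: wf_score_ballot.
have pc : perm_eq (map (code x y) bs) (map (code x y) bs2).
  apply: (perm_code wf wf2) => //; rewrite pro2 b0yx (negbTE b0xy) /p;
    move: big1 leT proT proxy; rewrite -sT;
    move: (size T) (pro x y bs) (pro y x bs) (pro x y T) (pro y x T); clear; lia.
have [bs' pb ecode] := perm_eq_map_lift pc.
have wfl' : wf_lists vs X' bs'.
  split=> //; first by rewrite (perm_size pb) sz2.
  by move=> b; rewrite (perm_mem pb); apply: wf2.
have yF : y \notin F (prof vs X' bs').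
  apply: wit; first exact: wf_prof.
  apply: iia_rel_prof => // a c; rewrite !X'E => aC cC nS.
  have -> : Margin (prof vs X' bs') a c = m%:Z * ((c == next C a)%:Z - (a == next C c)%:Z).
    have [_ sz' _ _ _] := wfl'; rewrite Margin_prof // -netT //.
    rewrite !(perm_pro _ _ pb) !pro2 [(_ + ((a, c) \in _))%N]addnC.
    by move: (pro a c T) (pro c a T) (p * _)%N; clear; lia.
  case: eqP => [e|_] h; last first.
    by exfalso; move: h m0; case: eqP => _; clear; lia.
  (* The edge leaving [x] goes to [y], and this pair is exempt from the comparison. *)
  have ax : a != x.
    by apply/eqP => ax; apply: nS; rewrite e ax nx !inE !eqxx orbT.
  by have := edge a aC ax; rewrite -e -/P; move: m0 h; case: eqP => _; move: (Margin P _ _); clear; split; lia.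
have p2 : (p + p <= size vs)%N by rewrite -sz -sz2 szT leq_addr.
have wflT : wf_lists (drop (p + p) vs) X' bsT.
  have sd : size bsT = size (drop (p + p) vs).
    by by rewrite size_drop -sz -sz2 szT /bsT size_cat size_nseq addKn.
  split=> //; first exact: drop_uniq.
  by rewrite -sd /bsT size_cat sT addn_gt0 !muln_gt0 m0.
(* The pairs are given to the first [p + p] voters and removed by Neutral Reversal. The cycle blocks
   and indifferent ballots that remain are invariant under rotation, so [y] wins. *)
move: yF; rewrite (perm_prof anon wfl' pb) -(cat_take_drop (p + p) vs).
rewrite pairs_prof ?cat_take_drop // ?size_takel //; last exact: wf_score_ballot.
apply/negP; rewrite negbK; apply: cyclic_winners => //.
rewrite map_cat map_nseq; apply: perm_cat; first exact: perm_cycle_ballots.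
suff -> : relabel (next C) fset0 = fset0 by [].
by rewrite /relabel; apply/fsetP => t; rewrite !inE; apply/imfsetP => -[].
Qed.

Lemma SC_excludes P y : wf_profile P -> y \in pX P -> y \notin F P -> y \notin SC P.
Proof.
move=> wfP yX yF.
have [vs0 [bs0 [wfl0 eP]]] := wf_profile_prof wfP.
set X := pX P in yX wfl0 eP; have [uv0 sz0 n0 X0 wf0] := wfl0.
pose n := size vs0; pose K := (2 * (n * #|` X|) + n)%N.
have [ws2 sw2 uw2] := fresh_voters (K + K) infV uv0.
have [ws1 sw1 uw1] := fresh_voters ((n + K) + (n + K)) infV uw2.
(* With its converse, [b0] adds one voter on each side between [y] and every other candidate,
   whichever one turns out to be [x]. *)
pose b0 := score_ballot X (fun z => z == y).
pose bs1 := pairs K b0 ++ bs0; pose vs1 := ws2 ++ vs0.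
have wfb0 : wf_ballot X b0 := wf_score_ballot X _.
have wfl1 : wf_lists vs1 X bs1.
  split=> //; first by rewrite !size_cat size_pairs sw2 sz0.
    by rewrite size_cat; lia.
  move=> b; rewrite mem_cat => /orP [/mem_pairs [] ->|/wf0 //] //.
  exact: wf_converse.
(* Pairs of indifferent ballots enlarge the electorate without raising any [pro], as the second size
   bound demands. *)
pose bs := pairs (n + K) (fset0 : ballot Xt) ++ bs1; pose vs := ws1 ++ vs1.
have [uv1 sz1 n1 _ wf1] := wfl1.
have wfl : wf_lists vs X bs.
  split=> //; first by rewrite !size_cat size_pairs sw1 -[(size _ + size _)%N]size_cat sz1 size_cat.
    by rewrite size_cat; lia.
  move=> b; rewrite mem_cat => /orP [/mem_pairs [] ->|/wf1 //]; rewrite ?converse0; exact: wf_ballot0.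
have eF : F (prof vs X bs) = F P.
  by rewrite eP /vs pairs_prof // ?pairs_prof //; apply: wf_ballot0.
have proE a c : pro a c bs = (K * (((a, c) \in b0) + ((c, a) \in b0)) + pro a c bs0)%N.
  by rewrite /bs /bs1 !pro_cat !pro_pairs !inE muln0 add0n.
have [uv sz _ _ _] := wfl.
have ME a c : Margin (prof vs X bs) a c = Margin P a c.
  rewrite Margin_prof // eP Margin_prof // !proE [(_ + ((a, c) \in _))%N]addnC.
  by move: (K * _)%N (pro a c bs0) (pro c a bs0); clear; lia.
have [x [xX wit]] : exists x, x \in X /\
    forall P', wf_profile P' -> iia_rel (prof vs X bs) P' x y -> y \notin F P'.
  by have [|x [xX wit]] := iia (wf_prof wfl) (y := y); [rewrite eF|exists x].
have [xy lt_yx] := IIA_witness_pro wfl xX yX wit.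
have MPx : Margin P x y = (pro x y bs - pro y x bs)%N%:Z.
  by rewrite -ME Margin_prof //; lia.
apply/(not_in_SC wfP yX); exists x; split; first by rewrite MPx; lia.
rewrite MPx => /reach_uniq [s [ps ls us]].
have sub : {subset y :: s <= enum_fset X}.
  have k0 : 0 < (pro x y bs - pro y x bs)%N%:Z :> int by move: lt_yx; clear; lia.
  have inX t a : path (fun a c => (pro x y bs - pro y x bs)%N%:Z <= Margin P a c) a t ->
      all (fun z => z \in X) t.
    elim: t a => //= c t IH a /andP [ac /IH ->].
    by have [_ ->] := Margin_gt0_mem wfP (lt_le_trans k0 ac).
  have := inX _ _ ps.
  by move=> /allP sX z; rewrite inE => /predU1P [->|/sX].
have szC : (size (y :: s) <= #|` X|)%N by apply: uniq_leq_size sub.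
have b0yx : (y, x) \in b0 by rewrite in_score_ballot yX xX eqxx (negbTE xy).
have b0xy : (x, y) \notin b0 by rewrite in_score_ballot yX xX eqxx (negbTE xy).
have le0 : (pro x y bs0 <= n)%N by rewrite /n -sz0; apply: count_size.
have Exy : pro x y bs = (K + pro x y bs0)%N by rewrite proE b0yx (negbTE b0xy) muln1.
have Eyx : pro y x bs = (K + pro y x bs0)%N by rewrite proE b0yx (negbTE b0xy) muln1.
have szb : size bs = (n + K + (n + K) + (K + K + n))%N.
  by rewrite /bs /bs1 !size_cat !size_pairs sz0.
have lt_mul : ((pro x y bs - pro y x bs) * size (y :: s) <= n * #|` X|)%N.
  by apply: leq_mul => //; rewrite Exy Eyx subnDl; apply: leq_trans (leq_subr _ _) le0.
apply: (cycle_blocks_exclusion (m := (pro x y bs - pro y x bs)%N) wfl wit xy _ _ _ _ _ ls us).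
- by rewrite subnK // ltnW.
- by rewrite subn_gt0.
- by rewrite -mulnA {2}Exy /K; move: lt_mul;
    move: (_ * size _)%N (n * _)%N (pro x y bs0) => t u p; clear; lia.
- by rewrite szb -mulnA; rewrite {2}Exy /K; move: lt_mul le0;
    move: (_ * size _)%N (n * _)%N (pro x y bs0) => t u p; clear; lia.
by apply: sub_path ps => a c; rewrite ME.
Qed.

End Refinement.

(** * F is contained in SC *)

Section Inclusion.
Variables (Vt Xt : choiceType) (F : VSCC Vt Xt).
Implicit Types (X : {fset Xt}) (a c x y z : Xt) (v w : Vt) (vs ws : seq Vt)
  (bs : seq (ballot Xt)) (b : ballot Xt).

Lemma prof_double vs ws X bs : wf_lists vs X bs -> uniq (ws ++ vs) -> size ws = size vs ->
  wf_lists (ws ++ vs) X (bs ++ bs) /\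
  is_double (prof vs X bs) (prof (ws ++ vs) X (bs ++ bs)).
Proof.
move=> [uv sz n0 X0 wf] uw sw; split.
  split=> //; first by rewrite !size_cat sz sw.
    by rewrite size_cat ltn_addl.
  by move=> b; rewrite mem_cat orbb; apply: wf.
(* The old voters are their own originals; each new voter copies the old one at the same
   position. *)
split=> //; pose f w := if w \in vs then w else nth w vs (index w ws).
move: (uw); rewrite cat_uniq => /and3P [uws /hasPn dis _].
have fvs w : w \in vs -> f w = w by rewrite /f => ->.
have fws w : w \in ws -> f w = nth w vs (index w ws).
  by rewrite /f; case: ifP => // /dis /= /negbTE ->.
have mapws : map f ws = vs.
  case: ws vs n0 sw uws {uv sz uw dis fvs} @f fws => [|v0 ws] [|v1 vs] // _ sw uws f fws.
  apply: (eq_from_nth (x0 := v0)); rewrite size_map // => i iw.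
  rewrite (nth_map v0) // fws ?mem_nth // index_uniq //.
  by apply: set_nth_default; rewrite -sw.
exists f; split.
- move=> w; rewrite !mem_pV_prof mem_cat => /orP [ww|vw]; last by rewrite fvs.
  by rewrite -mapws map_f.
- move=> v; rewrite mem_pV_prof => vv; rewrite fset_count.
  have /permP -> : perm_eq (pV (prof (ws ++ vs) X (bs ++ bs))) (ws ++ vs).
    by apply: uniq_perm; rewrite ?fset_uniq // => w; apply: mem_pV_prof.
  rewrite count_cat -(count_map f (pred1 v)) mapws.
  have -> : count (fun w => f w == v) vs = count (pred1 v) vs.
    by apply: eq_in_count => w /fvs /= ->.
  by rewrite !count_uniq_mem // vv.
move=> w a c; rewrite mem_pV_prof => wv; rewrite !ranks_prof wv.
move: wv; rewrite mem_cat index_cat; case: ifP => [ww _|nww /= wv].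
  have iw : (index w ws < size vs)%N by rewrite -sw index_mem.
  by rewrite fws // mem_nth // index_uniq // nth_cat sz iw.
by rewrite fvs // wv nth_cat sz sw ltnNge leq_addr /= addKn.
Qed.

Lemma adds_voter_prof vs X bs v b : v \notin vs ->
  adds_voter (prof vs X bs) (prof (v :: vs) X (b :: bs)) v.
Proof.
move=> nv; split; rewrite ?mem_pV_prof //.
  by apply/fsetP => w; rewrite !inE.
move=> w a c; rewrite mem_pV_prof => wv; rewrite !ranks_prof inE wv orbT /=.
by case: eqP => // e; rewrite e wv in nv.
Qed.

Hypotheses (infV : infinite_type Vt) (dh : Downward_Homogeneity F)
  (cd : Coherent_Defeat F) (tpi : Tolerant_Positive_Involvement F).

(* [S] is the set of candidates reachable from [y] by strong edges. Each added
   ballot lowers every positive margin from [S] to its complement, but raises the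
   nonpositive margins of [y] itself, which thus end up alternating between 0 and 1;
   the parity condition makes them end at 0. *)
Lemma not_winner_of_weak_cut (r : nat) vs X bs (S : pred Xt) x y :
  wf_lists vs X bs -> y \in F (prof vs X bs) ->
  x \in X -> y \in X -> S y -> ~~ S x ->
  Margin (prof vs X bs) x y = r.+2%:Z ->
  (forall z, z \in X -> ~~ S z ->
     (Margin (prof vs X bs) y z <= r%:Z \/ Margin (prof vs X bs) y z <= 1) /\
     exists k : int, Margin (prof vs X bs) y z = r%:Z + 2 * k) ->
  (forall a z, a \in X -> z \in X -> S a -> a != y -> ~~ S z ->
     Margin (prof vs X bs) a z <= r%:Z) -> False.
Proof.
elim: r vs bs => [|r IH] vs bs wfl yF xX yX Sy nSx Mxy My MS; have wfP := wf_prof wfl.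
  suff : y \notin F (prof vs X bs) by rewrite yF.
  apply: (cd (x := x)) => //; first by rewrite Mxy.
  move=> [s [_ ls _ sX ps]].
  (* At [r = 0] a margin of [y] across the cut is even and at most 1, hence not positive. So [S] is
     closed under majority edges, and no majority path from [y] reaches [x]. *)
  have stay a c : a \in X -> c \in X -> S a -> 0 < Margin (prof vs X bs) a c -> S c.
    move=> aX cX Sa M0; apply/negPn/negP => nSc; move: M0.
    have [->|ay] := eqVneq a y; last by rewrite ltNge (MS a c).
    by have [h [k]] := My c cX nSc; move: (Margin _ _ _) h; clear; lia.
  suff : S (last y s) by rewrite ls (negbTE nSx).
  elim: s (y) sX ps Sy {ls} => //= c s IHs a /and3P [aX cX sX] /andP [ac cs] Sa.
  by apply: IHs; rewrite ?cX ?sX //; apply: stay ac.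
have [uv sz n0 X0 wf] := wfl.
have [[|v []] // _ /andP [nv _]] := fresh_voters 1 infV uv.
set M := Margin (prof vs X bs) in Mxy My MS.
(* [y] scores 2, above the rest of [S] (0) and the outsiders it does not beat (1), as Tolerant
   Positive Involvement requires. Outsiders beaten by [y] get 3, so that these margins fall too. *)
pose h z := if S z then (z == y).*2 else if 0 < M y z then 3 else 1%N.
pose b := score_ballot X h.
have wfl' : wf_lists (v :: vs) X (b :: bs).
  split; rewrite //= ?nv ?sz // => d; rewrite inE => /predU1P [->|/wf //].
  exact: wf_score_ballot.
have M' a c : Margin (prof (v :: vs) X (b :: bs)) a c =
    M a c + ((a, c) \in b)%:Z - ((c, a) \in b)%:Z.
  have [uv' sz' _ _ _] := wfl'; rewrite /M !Margin_prof // /pro /=.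
  by move: (count _ bs) (count _ bs) => p q; clear; lia.
have M'S a z : a \in X -> z \in X -> S a -> a != y -> ~~ S z ->
    Margin (prof (v :: vs) X (b :: bs)) a z = M a z - 1.
  move=> aX zX Sa ay nSz; rewrite M' !in_score_ballot aX zX /h Sa (negbTE ay) (negbTE nSz) /=.
  by case: ifP => _; rewrite addr0.
have M'y z : z \in X -> ~~ S z ->
    Margin (prof (v :: vs) X (b :: bs)) y z = if 0 < M y z then M y z - 1 else M y z + 1.
  move=> zX nSz; rewrite M' !in_score_ballot yX zX /h Sy eqxx (negbTE nSz) /=.
  by case: ifP => _; rewrite ?addr0 ?subr0.
have Myx : M y x = - r.+3%:Z by rewrite /M MarginC -Mxy.
apply: (IH (v :: vs) (b :: bs)) => //.
- apply: (tpi wfP (wf_prof wfl') yF (adds_voter_prof X bs b nv)) => z zX zy nmaj.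
  rewrite ranks_prof mem_head /= eqxx in_score_ballot yX zX /h Sy eqxx /=.
  rewrite /maj_pref -/M in nmaj.
  by rewrite (negbTE nmaj) (negbTE zy); case: (S z).
- by rewrite MarginC M'y // Myx /=; clear; lia.
(* Both [r] and the margin change by 1, so their difference stays even; a margin that was not
   positive rises to at most 1, the second alternative of the bound. *)
- move=> z zX nSz; rewrite M'y //; have [le [k]] := My z zX nSz.
  move: (M y z) le; clear => m le e; case: ifP => M0; split; try lia.
    by exists k; lia.
  by exists (k + 1); lia.
move=> a z aX zX Sa ay nSz; rewrite M'S //; have := MS a z aX zX Sa ay nSz.
by move: (M a z); clear; lia.
Qed.

Lemma SC_includes P y : wf_profile P -> y \in pX P -> y \in F P -> y \in SC P.
Proof.
move=> wfP yX yF; apply/negPn/negP => /(not_in_SC wfP yX) [x [M0 H]].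
have [xX _] := Margin_gt0_mem wfP M0.
have [vs [bs [wfl eP]]] := wf_profile_prof wfP; have [uv sz _ _ _] := wfl.
have [ws sw uw] := fresh_voters (size vs) infV uv.
have [wfl2 dbl] := prof_double wfl uw sw.
rewrite -eP in dbl; set P2 := prof _ _ _ in dbl.
have M2 a c : Margin P2 a c = 2 * Margin P a c.
  by rewrite /Margin !(n_above_double _ _ dbl); clear; lia.
have yF2 : y \in F P2 by move: yF; apply/fsubsetP/dh => //; apply: wf_prof.
(* Here [m] is the margin of [x] over [y] minus one, which is also the bound for original margins
   across the cut. *)
have [m Mxy] : exists m : nat, Margin P x y = m.+1%:Z.
  by case: (Margin P x y) M0 => // -[|m] // _; exists m.
rewrite Mxy in H; pose S z := pdec (reach (Margin P) m.+1%:Z y z).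
have Sy : S y by apply/pdecP; apply: reach_refl.
have weak a z : S a -> ~~ S z -> Margin P a z <= m%:Z.
  move=> /pdecP ya nz; rewrite leNgt; apply: contra nz => lt; apply/pdecP.
  by apply: reach_trans ya _; apply: reach_edge; move: lt; clear; lia.
(* Doubling turns the margin [m.+1] into [(2 * m).+2] and the bound [m] into [2 * m], whence this
   [r]; all doubled margins have its parity. *)
apply: (not_winner_of_weak_cut (r := (2 * m)%N) (S := S) (x := x) wfl2 yF2) => //.
- exact/pdecP.
- by rewrite -/P2 M2 Mxy; clear; lia.
- move=> z _ nSz; rewrite -/P2 M2; have := weak y z Sy nSz.
  move: (Margin P y z); clear => k le; split; first by left; lia.
  by exists (k - m%:Z); lia.
move=> a z _ _ Sa _ nSz; rewrite -/P2 M2; have := weak a z Sa nSz.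
by move: (Margin P a z); clear; lia.
Qed.

End Inclusion.

(** * The characterization of Split Cycle *)

Lemma homogeneity_downward (Vt Xt : choiceType) (F : VSCC Vt Xt) :
  Homogeneity F -> Downward_Homogeneity F.
Proof. by move=> hom P P' wfP wfP' dbl; rewrite (hom P P'). Qed.

Lemma SC_characterization (Vt Xt : choiceType) (F : VSCC Vt Xt) :
  infinite_type Vt -> is_VSCC F -> Anonymity F -> Neutrality F ->
  Downward_Homogeneity F -> Neutral_Reversal F -> Monotonicity_two F ->
  Coherent_IIA F -> Coherent_Defeat F -> Tolerant_Positive_Involvement F ->
  forall P, wf_profile P -> F P = SC P.
Proof.
move=> infV vscc anon neut dh rev mono iia cd tpi P wfP; apply/fsetP => y.
have [_ /fsubsetP subF] := vscc P wfP.
have [_ /fsubsetP subSC] := SC_VSCC wfP.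
apply/idP/idP => h; first by apply: (SC_includes infV dh cd tpi) => //; apply: subF.
have yX := subSC y h; move: h; apply: contraLR => yF.
exact: (SC_excludes infV vscc anon neut rev mono iia).
Qed.


Theorem theorem7p11 (Vt Xt : choiceType) :
  infinite_type Vt -> infinite_type Xt ->
  (* (i) *)
  [/\ [/\ is_VSCC (@SC Vt Xt), Anonymity (@SC Vt Xt), Neutrality (@SC Vt Xt),
      Homogeneity (@SC Vt Xt) & Downward_Homogeneity (@SC Vt Xt)],
      [/\ Neutral_Indifference (@SC Vt Xt), Neutral_Reversal (@SC Vt Xt)
        & Monotonicity (@SC Vt Xt)]
      &
      [/\ Coherent_IIA (@SC Vt Xt), Coherent_Defeat (@SC Vt Xt)
        & Tolerant_Positive_Involvement (@SC Vt Xt)]]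
  /\
  (* (ii) *)
  (forall F : VSCC Vt Xt, is_VSCC F ->
     Anonymity F -> Neutrality F -> Downward_Homogeneity F ->
     Neutral_Indifference F -> Neutral_Reversal F -> Monotonicity_two F ->
     Coherent_IIA F -> Coherent_Defeat F -> Tolerant_Positive_Involvement F ->
     forall P, wf_profile P -> F P = SC P)
  /\
  (* (iii) *)
  (forall F : VSCC Vt Xt, is_VSCC F ->
     Anonymity F -> Neutrality F -> Homogeneity F ->
     Neutral_Reversal F -> Monotonicity_two F ->
     Coherent_IIA F -> Coherent_Defeat F -> Tolerant_Positive_Involvement F ->
     forall P, wf_profile P -> F P = SC P).
Proof.
move=> infV _; split; [split; split | split].
- exact: SC_VSCC.
- exact: SC_anonymity.
- exact: SC_neutrality.
- exact: SC_homogeneity.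
- exact/homogeneity_downward/SC_homogeneity.
- exact: SC_neutral_indifference.
- exact: SC_neutral_reversal.
- exact: SC_monotonicity.
- exact: SC_coherent_IIA.
- exact: SC_coherent_defeat.
- exact: SC_tolerant_positive_involvement.
- move=> F vscc anon neut dh _ rev mono iia cd tpi.
  exact: SC_characterization.
move=> F vscc anon neut /homogeneity_downward dh rev mono iia cd tpi.
exact: SC_characterization.
Qed.
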